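(* Let $\Delta\ge 0$, let $n,m\ge 1$ be integers, and let $f:\mathcal X^n\times\mathbb R^m\to\mathbb R^n$ be Lipschitz on bounded sets with $f(0,0)=0$. Assume that there exist a functional $V:\mathcal X^n\to\mathbb R_{\ge 0}$ which is Lipschitz on bounded sets, constants $\underline a,\overline a,a>0$ and $c\ge 0$, and a function $\gamma\in\mathcal N$ such that, for all $\phi\in\mathcal X^n$ and all $v\in\mathbb R^m$, $$\underline a|\phi(0)|^2\le V(\phi)\le \overline a\|\phi\|^2,$$ $$D^+V(\phi,f(\phi,v))\le -a|\phi(0)|^2+c\|\phi\|^2+\gamma(|v|).$$ Assume further that there exist a symmetric positive definite matrix $P\in\mathbb R^{n\times n}$ and a constant $\sigma>0$ such that, for all $\phi\in\mathcal X^n$ and all $v\in\mathbb R^m$, $$\phi(0)^\top P f(\phi,v)\ge -\sigma\left(\|\phi\|^2+\gamma(|v|)\right).$$ Then there exists $\bar c>0$ such that, if $c\in[0,\bar c)$, the system $\dot x(t)=f(x_t,u(t))$ is exp-ISS. If, in addition, there exists $\gamma_0\ge 0$ such that $\gamma(s)=\gamma_0 s^2$ for all $s\ge 0$, then the system is exp-ISS with linear gain.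
   Context: $\mathcal X^n$ is the set of continuous functions $\phi:[-\Delta,0]\to\mathbb R^n$, with $\|\phi\|=\max_{\tau\in[-\Delta,0]}|\phi(\tau)|$, where $|\cdot|$ is the Euclidean norm. A map is Lipschitz on bounded sets if its restriction to every bounded set is Lipschitz. $\mathcal U^m$ is the set of Lebesgue measurable, locally essentially bounded signals $u:\mathbb R_{\ge 0}\to\mathbb R^m$; $u_{[0,t]}$ is the restriction of $u$ to $[0,t]$ and $\|u_{[0,t]}\|$ its essential supremum norm. For a continuous $x:[-\Delta,T)\to\mathbb R^n$ and $t\in[0,T)$, $x_t\in\mathcal X^n$ is $x_t(\tau):=x(t+\tau)$, $\tau\in[-\Delta,0]$. For an initial state $x_0\in\mathcal X^n$ and $u\in\mathcal U^m$, the solution of $\dot x(t)=f(x_t,u(t))$ is the (unique, maximal) locally absolutely continuous solution, the equation holding for almost every $t\geq 0$ in the existence interval. Class $\mathcal N$: functions $\mathbb R_{\ge 0}\to\mathbb R_{\ge 0}$ that are continuous, non-decreasing and zero at zero. Driver derivative: for $V:\mathcal X^n\to\mathbb R_{\ge 0}$, $\phi\in\mathcal X^n$, $w\in\mathbb R^n$, $D^+V(\phi,w):=\limsup_{h\to 0^+}\frac{V(\phi_{h,w})-V(\phi)}{h}$, where for $h\in[0,\Delta)$, $\phi_{h,w}(s):=\phi(s+h)$ if $s\in[-\Delta,-h)$ and $\phi_{h,w}(s):=\phi(0)+(h+s)w$ if $s\in[-h,0]$. (If $\Delta=0$, $\mathcal X^n$ is identified with $\mathbb R^n$ and $\phi_{h,w}:=\phi(0)+hw$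 for $h\geq 0$.) Exp-ISS: the system is exp-ISS if there exist $k,\eta>0$ and $\mu\in\mathcal N$ such that, for all $x_0\in\mathcal X^n$ and all $u\in\mathcal U^m$, the solution exists for all $t\ge 0$ and satisfies $|x(t)|\le k\|x_0\|e^{-\eta t}+\mu(\|u_{[0,t]}\|)$ for all $t\ge 0$. It is exp-ISS with linear gain if this holds with $\mu(s)=\mu_0 s$ for some $\mu_0\ge 0$. *)

(* Defs.v *)
From mathcomp Require Import all_boot all_order all_algebra.
From mathcomp Require Import all_classical all_reals all_analysis ess_sup_inf measurable_realfun.
Import Order.TTheory GRing.Theory Num.Theory.
Import numFieldNormedType.Exports.

Set Implicit Arguments.
Unset Strict Implicit.
Unset Printing Implicit Defensive.

Local Open Scope classical_set_scope.
Local Open Scope ring_scope.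

Section Defs.
Context {R : realType}.
Implicit Types (Delta : R) (n m : nat).

(* The Euclidean norm; the library's norm on ['cV[R]_n] is the max norm, which
   induces the same topology. *)
Definition enorm n (v : 'cV[R]_n) : R := Num.sqrt (\sum_i v i 0 ^+ 2).

(* Elements of X^n are represented by total functions [R -> 'cV[R]_n] that are
   continuous on [-Delta, 0]; their values elsewhere are irrelevant.  A map f
   on X^n is a total function on [R -> 'cV[R]_n]; it is only ever constrained
   or evaluated on X^n, where being Lipschitz on bounded sets forces it to
   depend on nothing but the restriction of its argument to [-Delta, 0]. *)
Definition cstate Delta n : set (R -> 'cV[R]_n) :=
  [set phi | {within `[- Delta, 0], continuous phi}].
Arguments cstate Delta n phi : clear implicits.

Definition supnorm Delta n (phi : R -> 'cV[R]_n) : R :=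
  sup [set enorm (phi tau) | tau in `[- Delta, 0]].

Definition lipschitz_bounded_V Delta n (V : (R -> 'cV[R]_n) -> R) : Prop :=
  forall B : set (R -> 'cV[R]_n), B `<=` cstate Delta n ->
    (exists r : R, forall phi, B phi -> supnorm Delta phi <= r) ->
  exists L : R, forall phi psi, B phi -> B psi ->
    `|V phi - V psi| <= L * supnorm Delta (phi - psi).

Definition lipschitz_bounded_f Delta n m
    (f : (R -> 'cV[R]_n) -> 'cV[R]_m -> 'cV[R]_n) : Prop :=
  forall B : set ((R -> 'cV[R]_n) * 'cV[R]_m),
    (forall p, B p -> cstate Delta n p.1) ->
    (exists r : R, forall p, B p -> supnorm Delta p.1 + enorm p.2 <= r) ->
  exists L : R, forall p q, B p -> B q ->
    enorm (f p.1 p.2 - f q.1 q.2)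
      <= L * (supnorm Delta (p.1 - q.1) + enorm (p.2 - q.2)).

(* Functions on the nonnegative half-line are total; only their values there
   matter. *)
Definition class_N (g : R -> R) : Prop :=
  [/\ {within `[0, +oo[, continuous g},
      {in `[0, +oo[ &, {homo g : s t / s <= t}} & g 0 = 0].

(* For Delta = 0 and s = 0 this is phi 0 + h *: w, and for Delta > 0 only
   h < Delta is relevant in the limit h -> 0+. *)
Definition shift_driver n (phi : R -> 'cV[R]_n) (h : R) (w : 'cV[R]_n) :
    R -> 'cV[R]_n :=
  fun s => if s < - h then phi (s + h) else phi 0 + (h + s) *: w.

(* Extended-real valued: the upper limit may be infinite, as phi is only
   continuous. *)
Definition driver_derivative n (V : (R -> 'cV[R]_n) -> R)
    (phi : R -> 'cV[R]_n) (w : 'cV[R]_n) : \bar R :=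
  limf_esup (fun h : R => ((V (shift_driver phi h w) - V phi) / h)%:E) 0^'+.

Definition ess_norm m (u : R -> 'cV[R]_m) (t : R) : \bar R :=
  ess_sup (@lebesgue_measure R)
    ((fun s => (enorm (u s))%:E) \_ `[0, t]).

(* Measurability is with respect to the completed (Lebesgue) sigma-algebra. *)
Definition lebesgue_measurable_fun (D : set R) (g : R -> R) : Prop :=
  @measurable_fun _ _
    (g_sigma_algebraType (completed_algebra_gen (@lebesgue_measure R))) R D g.

Definition input m (u : R -> 'cV[R]_m) : Prop :=
  (forall i, lebesgue_measurable_fun `[0, +oo[ (fun t => u t i 0)) /\
  (forall t : R, 0 <= t -> (ess_norm u t < +oo)%E).

Definition absolutely_continuous n (a b : R) (x : R -> 'cV[R]_n) : Prop :=
  forall e : R, 0 < e -> exists2 d : R, 0 < d &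
    forall (N : nat) (s t : 'I_N -> R),
      (forall i, a <= s i <= t i /\ t i <= b) ->
      (forall i j, i != j -> t i <= s j \/ t j <= s i) ->
      \sum_i (t i - s i) < d ->
      \sum_i enorm (x (t i) - x (s i)) < e.

Definition segment n (x : R -> 'cV[R]_n) (t : R) : R -> 'cV[R]_n :=
  fun tau => x (t + tau).

Record solution Delta n m (f : (R -> 'cV[R]_n) -> 'cV[R]_m -> 'cV[R]_n)
    (x0 : R -> 'cV[R]_n) (u : R -> 'cV[R]_m)
    (T : \bar R) (x : R -> 'cV[R]_n) : Prop := Solution {
  solution_gt0 : (0 < T)%E ;
  solution_cont : {within [set t : R | - Delta <= t /\ (t%:E < T)%E],
                     continuous x} ;
  solution_init : {in `[- Delta, 0], x =1 x0} ;
  solution_lac : forall b : R, 0 <= b -> (b%:E < T)%E ->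
    absolutely_continuous 0 b x ;
  solution_eq : {ae @lebesgue_measure R, forall t : R,
    0 <= t -> (t%:E < T)%E -> is_derive t (1 : R) x (f (segment x t) (u t))} }.

Definition maximal_solution Delta n m
    (f : (R -> 'cV[R]_n) -> 'cV[R]_m -> 'cV[R]_n)
    (x0 : R -> 'cV[R]_n) (u : R -> 'cV[R]_m)
    (T : \bar R) (x : R -> 'cV[R]_n) : Prop :=
  solution Delta f x0 u T x /\
  forall (T' : \bar R) (x' : R -> 'cV[R]_n), solution Delta f x0 u T' x' ->
    (forall t : R, - Delta <= t -> (t%:E < T)%E -> x' t = x t) ->
    (T' <= T)%E.

(* The exp-ISS estimate with gain mu.  Existence of a maximal solution is
   stated explicitly, so that the clause on all of them is not vacuous. *)
Definition exp_ISS_estimate Delta n m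
    (f : (R -> 'cV[R]_n) -> 'cV[R]_m -> 'cV[R]_n) (k eta : R) (mu : R -> R) :
    Prop :=
  forall (x0 : R -> 'cV[R]_n) (u : R -> 'cV[R]_m),
    cstate Delta n x0 -> input u ->
    (exists T x, maximal_solution Delta f x0 u T x) /\
    (forall T x, maximal_solution Delta f x0 u T x ->
       T = +oo%E /\
       forall t : R, 0 <= t ->
         enorm (x t) <= k * supnorm Delta x0 * expR (- eta * t)
                        + mu (fine (ess_norm u t))).

Definition exp_ISS Delta n m
    (f : (R -> 'cV[R]_n) -> 'cV[R]_m -> 'cV[R]_n) : Prop :=
  exists (k eta : R) (mu : R -> R),
    [/\ 0 < k, 0 < eta, class_N mu & exp_ISS_estimate Delta f k eta mu].

Definition exp_ISS_linear_gain Delta n m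
    (f : (R -> 'cV[R]_n) -> 'cV[R]_m -> 'cV[R]_n) : Prop :=
  exists k eta mu0 : R,
    [/\ 0 < k, 0 < eta, 0 <= mu0
      & exp_ISS_estimate Delta f k eta (fun s => mu0 * s)].

Definition symmetric_posdef n (P : 'M[R]_n) : Prop :=
  P^T = P /\ forall v : 'cV[R]_n, v != 0 -> 0 < (v^T *m P *m v) 0 0.

End Defs.

Arguments cstate {R} Delta n phi.

(* Main.v *)
Require Import Defs.
From mathcomp Require Import all_boot all_order all_algebra.
From mathcomp Require Import all_classical all_reals all_analysis.
From mathcomp Require Import ess_sup_inf measurable_realfun ring lra.
Import Order.TTheory GRing.Theory Num.Theory.
Import numFieldNormedType.Exports.

(* Let E(t) = ||x_t||^2 and let g bound gamma(|u|).  The sandwich and dissipation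
   inequalities for V give, over a horizon T with 2 c T <= alow,
   |x(t)|^2 <= K1 E(s) + K2 g for s <= t <= s + T with K1 = 2 aup / alow
   independent of T.  The lower bound on (x^T P x)' prevents |x|^2 from dropping
   quickly, so if x^T P x were not small throughout one of the N windows of length
   Delta contained in the horizon, then V(x_t) would decrease by a fixed fraction
   of E(s) + G g on each of them, and become negative for N large.  Hence some
   window is small, E(s + T) <= E(s) / 2 + Ga g, and iterating gives the estimate.

   V(x_t) need not be absolutely continuous when x_0 is merely continuous.
   However the driver inequality holds for all states and all inputs, so at every
   time the upper right Dini derivative of V(x_t) is bounded, and off a null set
   it obeys the dissipation inequality; covering the null set by an open set of
   small measure is enough to integrate this.

   Solutions are fixed points of the Picard operator of a truncation of f, which
   contracts by 1/2 in the norm with weight exp(2 L t); the a priori estimate shows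
   that the truncation is never active. *)

Set Implicit Arguments.
Unset Strict Implicit.
Unset Printing Implicit Defensive.

Local Open Scope classical_set_scope.
Local Open Scope ring_scope.

(** * The Euclidean norm and quadratic forms *)

Section EuclideanNorm.
Context {R : realType}.

(** The order of choices shapes the estimate. The growth factor [K1] fixes how small [x^T P x] has
    to be on a window; this fixes [ep], then the duration [r] of a drop of [V], then the number [N]
    of windows, and only then the horizon [T]. A growth factor depending on [T] would make this
    circular; the smallness of [c] comes last, as [2 * c * T <= alow]. These constants depend on
    [Delta], [P] and the scalar bounds alone, never on [f], [V] or [gamma]; therefore the argument
    runs on bare real functions, collected in the record [dissipative], and [cbar] can be fixed
    before the system.

    [V] is not compared with itself along the trajectory: it dissipates only through [|x(t)|], while
    its upper bound involves the whole window, so one counts drops instead of proving decay of [V].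

    A Dini derivative bounded off a null set only would not suffice for integration, as the Cantor
    function shows; hence the interest of a finite bound at every time.

    The estimate is stated for trajectories on a bounded interval, so it is available before
    existence is known. *)

Lemma quadratic_discr_le (A B C : R) :
  (forall t, 0 <= A + 2 * B * t + C * t ^+ 2) -> B ^+ 2 <= A * C.
Proof.
move=> H; have A0 : 0 <= A by move: (H 0); rewrite mulr0 expr0n/= mulr0 !addr0.
have [C0|Cneg|C0] := ltgtP 0 C.
- move: (H (- B / C)); rewrite -(ler_pM2r C0) mul0r => {}H.
  have E : (A + 2 * B * (- B / C) + C * (- B / C) ^+ 2) * C = A * C - B ^+ 2.
    by field; rewrite gt_eqF.
  by rewrite E in H; lra.
(* For [C < 0] the quadratic is negative at [- (t + 1)], where [t] makes [C * t] outweigh the other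
   coefficients; this case cannot occur. *)
- have := H ((A + 1 + 2 * `|B|) / - C + 1).
  set t := (X in X + 1) => H1.
  have t0 : 0 <= t by apply: divr_ge0; have := normr_ge0 B; lra.
  have tC : C * t = - (A + 1 + 2 * `|B|) by rewrite /t; field; rewrite ?oppr_eq0 lt_eqF.
  have := H (- (t + 1)).
  have -> : A + 2 * B * - (t + 1) + C * (- (t + 1)) ^+ 2 =
            A - 2 * B * (t + 1) + C * t * (t + 2) + C by ring.
  rewrite tC; have := mulr_ge0 A0 t0.
  have : - B * (t + 1) <= `|B| * (t + 1).
    by apply: ler_wpM2r; [lra|rewrite -normrN ler_norm].
  by have := mulr_ge0 (normr_ge0 B) t0; have := normr_ge0 B; lra.
- rewrite -C0 mulr0; have [->|B0] := eqVneq B 0; first by rewrite expr0n.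
  move: (H (- (A + 1) / (2 * B))); rewrite -C0.
  have -> : A + 2 * B * (- (A + 1) / (2 * B)) + 0 * (- (A + 1) / (2 * B)) ^+ 2 = - 1.
    by field.
  by lra.
Qed.

Definition bform n (P : 'M[R]_n) (u v : 'cV[R]_n) : R := (u^T *m P *m v) 0 0.

Lemma bformE n (P : 'M[R]_n) u v :
  bform P u v = \sum_i \sum_j u i 0 * P i j * v j 0.
Proof.
rewrite /bform mxE exchange_big/=; apply: eq_bigr => j _.
by rewrite mxE mulr_suml; apply: eq_bigr => i _; rewrite !mxE.
Qed.

Lemma bformDl n (P : 'M[R]_n) u v w :
  bform P (u + v) w = bform P u w + bform P v w.
Proof. by rewrite /bform linearD/= !mulmxDl mxE. Qed.

Lemma bformDr n (P : 'M[R]_n) u v w :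
  bform P w (u + v) = bform P w u + bform P w v.
Proof. by rewrite /bform mulmxDr mxE. Qed.

Lemma bformZl n (P : 'M[R]_n) a u v : bform P (a *: u) v = a * bform P u v.
Proof. by rewrite /bform linearZ/= -!scalemxAl mxE. Qed.

Lemma bformZr n (P : 'M[R]_n) a u v : bform P u (a *: v) = a * bform P u v.
Proof. by rewrite /bform -!scalemxAr mxE. Qed.

Lemma bformBr n (P : 'M[R]_n) u v w :
  bform P w (u - v) = bform P w u - bform P w v.
Proof. by rewrite bformDr -scaleN1r bformZr mulN1r. Qed.

Lemma bform_sym n (P : 'M[R]_n) u v : P^T = P -> bform P u v = bform P v u.
Proof.
move=> sP; rewrite !bformE exchange_big/=; apply: eq_bigr => j _.
by apply: eq_bigr => i _; rewrite -[in LHS]sP mxE; ring.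
Qed.

(** The form is nonnegative along the line [u + t *: v]; the claim is the discriminant bound for
    this quadratic in [t]. It serves twice: for the identity matrix, and for [P] in the coercivity
    bound. *)
Lemma bform_cauchy_schwarz n (P : 'M[R]_n) u v : P^T = P ->
  (forall w, 0 <= bform P w w) ->
  bform P u v ^+ 2 <= bform P u u * bform P v v.
Proof.
move=> sP P0; apply: quadratic_discr_le => t.
have := P0 (u + t *: v).
rewrite bformDl !bformDr !bformZl !bformZr (bform_sym v u sP).
by rewrite (_ : _ + _ = bform P u u + 2 * bform P u v * t + bform P v v * t ^+ 2)//; ring.
Qed.

Lemma bform1 n (u v : 'cV[R]_n) : bform 1%:M u v = \sum_i u i 0 * v i 0.
Proof. by rewrite /bform mulmx1 mxE; apply: eq_bigr => i _; rewrite mxE. Qed.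

Lemma sum_sqr_ge0 n (v : 'cV[R]_n) : 0 <= \sum_i v i 0 ^+ 2.
Proof. by apply: sumr_ge0 => i _; rewrite sqr_ge0. Qed.

Lemma enorm_ge0 n (v : 'cV[R]_n) : 0 <= enorm v.
Proof. exact: sqrtr_ge0. Qed.

Lemma sqr_enorm n (v : 'cV[R]_n) : enorm v ^+ 2 = \sum_i v i 0 ^+ 2.
Proof. by rewrite sqr_sqrtr// sum_sqr_ge0. Qed.

Lemma bform1_enorm n (v : 'cV[R]_n) : bform 1%:M v v = enorm v ^+ 2.
Proof. by rewrite bform1 sqr_enorm; apply: eq_bigr => i _; rewrite expr2. Qed.

Lemma dot_le n (u v : 'cV[R]_n) : bform 1%:M u v <= enorm u * enorm v.
Proof.
have : bform 1%:M u v ^+ 2 <= (enorm u * enorm v) ^+ 2.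
  rewrite exprMn -!bform1_enorm; apply: bform_cauchy_schwarz.
    exact: trmx1.
  by move=> w; rewrite bform1_enorm sqr_ge0.
have := mulr_ge0 (enorm_ge0 u) (enorm_ge0 v).
by nra.
Qed.

Lemma enorm0 n : enorm (0 : 'cV[R]_n) = 0.
Proof. by rewrite /enorm big1 ?sqrtr0// => i _; rewrite mxE expr0n. Qed.

Lemma enormZ n (a : R) (v : 'cV[R]_n) : enorm (a *: v) = `|a| * enorm v.
Proof.
rewrite /enorm -sqrtr_sqr -sqrtrM ?sqr_ge0// mulr_sumr; congr Num.sqrt.
by apply: eq_bigr => i _; rewrite mxE exprMn.
Qed.

Lemma enormN n (v : 'cV[R]_n) : enorm (- v) = enorm v.
Proof. by rewrite -scaleN1r enormZ normrN1 mul1r. Qed.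

Lemma enormD n (u v : 'cV[R]_n) : enorm (u + v) <= enorm u + enorm v.
Proof.
rewrite -(@ler_pXn2r _ 2) ?nnegrE ?addr_ge0 ?enorm_ge0//.
rewrite -bform1_enorm bformDl !bformDr !bform1_enorm.
rewrite (bform_sym v u) ?trmx1//; have := dot_le u v; nra.
Qed.

Lemma enorm_distC n (u v : 'cV[R]_n) : enorm (u - v) = enorm (v - u).
Proof. by rewrite -enormN opprB. Qed.

Lemma enorm_coord n (v : 'cV[R]_n) i : `|v i 0| <= enorm v.
Proof.
rewrite -(@ler_pXn2r _ 2) ?nnegrE ?enorm_ge0// sqr_enorm real_normK ?num_real//.
by rewrite (bigD1 i)//= lerDl sumr_ge0// => j _; rewrite sqr_ge0.
Qed.

Lemma enorm_le_coord n (v : 'cV[R]_n) (r : R) :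
  (forall i, `|v i 0| <= r) -> enorm v <= n%:R * r.
Proof.
(* For [n = 0] no coordinate forces [0 <= r]; both sides are then zero. *)
move=> vr; have [n0|n0] := posnP n.
  rewrite /enorm big1 ?sqrtr0; last by move=> i; have := ltn_ord i; rewrite [in X in (_ < X)%N]n0.
  by rewrite n0 mul0r.
have r0 : 0 <= r by apply: le_trans (vr (Ordinal n0)).
rewrite -(@ler_pXn2r _ 2) ?nnegrE ?enorm_ge0 ?mulr_ge0// sqr_enorm.
apply: (@le_trans _ _ (\sum_(i < n) r ^+ 2)).
  apply: ler_sum => i _; rewrite -[v i 0 ^+ 2]real_normK ?num_real//.
  by rewrite ler_pXn2r ?nnegrE.
rewrite sumr_const card_ord -[_ *+ _]mulr_natl exprMn; apply: ler_wpM2r; first exact: sqr_ge0.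
by rewrite -natrX ler_nat -{1}(expn1 n) leq_pexp2l.
Qed.

Lemma enorm_eq0 n (v : 'cV[R]_n) : enorm v <= 0 -> v = 0.
Proof.
move=> v0; apply/matrixP => i j; rewrite ord1 mxE; apply/eqP.
by rewrite -normr_le0 (le_trans (enorm_coord v i)).
Qed.

Lemma enorm_cst1 (s : R) : enorm (const_mx s : 'cV[R]_1) = `|s|.
Proof. by rewrite /enorm big_ord1 mxE sqrtr_sqr. Qed.

Lemma mx_norm_le_enorm n (v : 'cV[R]_n) : `|v| <= enorm v.
Proof.
rewrite [leLHS]/Num.Def.normr/= mx_normrE bigmax_le ?enorm_ge0// => -[i j] _.
by rewrite ord1 enorm_coord.
Qed.

Lemma enorm_le_mx_norm n (v : 'cV[R]_n) : enorm v <= n%:R * `|v|.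
Proof.
apply: enorm_le_coord => i.
rewrite [leRHS]/Num.Def.normr/= mx_normrE.
exact: (le_bigmax _ (fun ij => `|v ij.1 ij.2|) (i, 0)).
Qed.

Lemma bform_bound n (P : 'M[R]_n) : exists2 C : R, 0 < C &
  forall u v, `|bform P u v| <= C * (enorm u * enorm v).
Proof.
exists (1 + \sum_i \sum_j `|P i j|) => [|u v].
  by rewrite ltr_wpDr// sumr_ge0// => i _; rewrite sumr_ge0.
rewrite bformE mulrDl mul1r -[leLHS]add0r lerD ?mulr_ge0 ?enorm_ge0//.
rewrite mulr_suml (le_trans (ler_norm_sum _ _ _))// ler_sum// => i _.
rewrite mulr_suml (le_trans (ler_norm_sum _ _ _))// ler_sum// => j _.
rewrite !normrM mulrAC (mulrC `|P i j|) ler_wpM2r//.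
by rewrite ler_pM ?enorm_coord.
Qed.

(** Algebraic, without compactness of the sphere: with [w = P^-1 v], Cauchy-Schwarz for [P] gives
    [|v|^4 = (v^T P w)^2 <= (v^T P v) (v^T P^-1 v)], and the last factor is at most [C |v|^2]. *)
Lemma posdef_coercive n (P : 'M[R]_n) : symmetric_posdef P ->
  exists2 c : R, 0 < c & forall v, c * enorm v ^+ 2 <= bform P v v.
Proof.
move=> [sP pP].
have P0 w : 0 <= bform P w w.
  have [->|/pP/ltW//] := eqVneq w 0.
  by rewrite /bform mulmx0 mxE.
have Pu : P \in unitmx.
  rewrite -row_free_unit -kermx_eq0; apply/rowV0P => v /sub_kermxP vP.
  apply/eqP; rewrite -trmx_eq0; apply/negP => /negP/pP.
  by rewrite trmxK vP mul0mx mxE ltxx.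
have [C C0 HC] := bform_bound (invmx P).
exists C^-1 => [|v]; first by rewrite invr_gt0.
set w := invmx P *m v.
have vw : bform P v w = enorm v ^+ 2.
  by rewrite /bform /w mulmxA mulmxK// -bform1_enorm /bform mulmx1.
have ww : bform P w w <= C * (enorm v ^+ 2).
  rewrite expr2; apply: le_trans (HC v v); apply: le_trans (ler_norm _).
  by rewrite /bform /w trmx_mul trmx_inv sP -!mulmxA [P *m _]mulKVmx.
have := bform_cauchy_schwarz v w sP P0; rewrite vw => cs.
have [v0|v0] := eqVneq (enorm v ^+ 2) 0; first by rewrite v0 mulr0.
have {}v0 : 0 < enorm v ^+ 2 by rewrite lt_def v0 sqr_ge0.
rewrite mulrC ler_pdivrMr// -(ler_pM2r v0) -expr2 (le_trans cs)//.
by rewrite -mulrA ler_wpM2l.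
Qed.

End EuclideanNorm.

(** * Induction along a real interval *)

Section RealInduction.
Context {R : realType}.

(** Supremum argument on the points up to which [P] holds. It drives the uniform continuity,
    comparison and continuation arguments below. *)
Lemma real_induction (P : R -> Prop) (a b : R) :
  P a ->
  (forall t, a <= t < b -> (forall s, a <= s <= t -> P s) ->
     exists2 d : R, 0 < d & forall s, t < s < t + d -> s <= b -> P s) ->
  (forall t, a < t <= b -> (forall s, a <= s < t -> P s) -> P t) ->
  forall t, a <= t <= b -> P t.
Proof.
move=> Pa Pstep Plim t0 /andP[at0 t0b].
pose S := [set t : R | a <= t <= b /\ forall s, a <= s <= t -> P s].
have ab : a <= b by exact: le_trans t0b.
have Sa : S a.
  split; first by rewrite lexx.
  by move=> s; rewrite -eq_le => /eqP <-.
have supS : has_sup S.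
  by split; [exists a|exists b => x [/andP[]]].
have aS : a <= sup S by apply: ub_le_sup => //; case: supS.
have Sb : sup S <= b by apply: ge_sup; [exists a|move=> x [/andP[]]].
have Pbelow s : a <= s < sup S -> P s.
  move=> /andP[as_ sS].
  have e0 : 0 < sup S - s by rewrite subr_gt0.
  have [x [Sx1 Sx2] sx] := sup_adherent e0 supS.
  by apply: Sx2; rewrite as_ ltW// (le_lt_trans _ sx)// opprB addrC subrK.
have PS : P (sup S).
  have [<-//|aS'] := eqVneq a (sup S).
  by apply: Plim => //; rewrite Sb andbT lt_neqAle aS' aS.
have Pbelow' s : a <= s <= sup S -> P s.
  rewrite (le_eqVlt s) => /andP[as_ /orP[/eqP ->//|sS]].
  by apply: Pbelow; rewrite as_.
have [bS|Sltb] := leP b (sup S).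
  by apply: Pbelow'; rewrite at0 (le_trans t0b).
have [|d d0 Hd] := Pstep (sup S) _ Pbelow'; first by rewrite aS.
exfalso.
pose c := Num.min b (sup S + d / 2).
have Sc : sup S < c by rewrite lt_min Sltb ltrDl divr_gt0.
have cd : c < sup S + d.
  by rewrite (@le_lt_trans _ _ (sup S + d / 2)) ?ge_min ?lexx ?orbT// ltrD2l ltr_pdivrMr// mulr_natr mulr2n ltrDl.
have cb : c <= b by rewrite ge_min lexx.
suff : c <= sup S by rewrite leNgt Sc.
apply: ub_le_sup; first by case: supS.
split; first by rewrite cb (le_trans aS (ltW Sc)).
move=> s /andP[as_ sc]; have [sS|Ss] := leP s (sup S).
  by apply: Pbelow'; rewrite as_.
by apply: Hd; rewrite ?Ss ?(le_lt_trans sc)// (le_trans sc).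
Qed.

End RealInduction.

(** * Continuity in terms of the Euclidean norm *)

Section Continuity.
Context {R : realType}.
Implicit Types n : nat.

Lemma enorm_cvgP n (x : R -> 'cV[R]_n) (A : set R) (t : R) :
  x @ within A (nbhs t) --> x t <->
  forall e : R, 0 < e -> exists2 d : R, 0 < d &
    forall s, A s -> `|s - t| < d -> enorm (x s - x t) <= e.
Proof.
split=> [/cvgrPdist_lt H e e0|H].
  have n0 : 0 < n%:R + 1 :> R by rewrite ltr_wpDl.
  have /nbhs_ballP[d /= d0 Hd] := H (e / (n%:R + 1)) (divr_gt0 e0 n0).
  exists d => // s As st; rewrite enorm_distC (le_trans (enorm_le_mx_norm _))//.
  have : `|x t - x s| < e / (n%:R + 1) by apply: Hd => //; rewrite /ball/= distrC.
  rewrite ltr_pdivlMr// mulrC mulrDl mul1r => /ltW; apply: le_trans.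
  by rewrite lerDl.
apply/cvgrPdist_lt => e e0.
have [d d0 Hd] := H (e / 2) (divr_gt0 e0 (ltr0n R 2)).
apply/nbhs_ballP; exists d => // s /= ts As.
rewrite distrC (le_lt_trans (mx_norm_le_enorm _))// (le_lt_trans (Hd _ As _))//.
  by rewrite distrC.
by rewrite ltr_pdivrMr// mulr_natr mulr2n ltrDl.
Qed.

Lemma enorm_within_continuousP n (x : R -> 'cV[R]_n) (A : set R) :
  {within A, continuous x} <->
  forall t, A t -> forall e : R, 0 < e -> exists2 d : R, 0 < d &
    forall s, A s -> `|s - t| < d -> enorm (x s - x t) <= e.
Proof.
rewrite subspace_continuousP.
by split=> H t At; apply/enorm_cvgP; exact: H.
Qed.

Lemma enorm_continuousP n (x : R -> 'cV[R]_n) :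
  continuous x <->
  forall (t e : R), 0 < e -> exists2 d : R, 0 < d &
    forall s, `|s - t| < d -> enorm (x s - x t) <= e.
Proof.
have -> : continuous x <-> {within [set: R], continuous x}.
  split; first exact: continuous_subspaceT.
  move=> /subspace_continuousP H t P HP; have HP' := H t I P HP.
  by apply: (@filterS _ (nbhs t) _ _ _ _ HP') => s; apply.
rewrite enorm_within_continuousP.
split=> H t; first by move=> e /(H t I)[d d0 Hd]; exists d => // s; exact: Hd.
by move=> _ e /(H t)[d d0 Hd]; exists d => // s _; exact: Hd.
Qed.

(** The nearest-point projection onto [[a, b]]: composing with it extends a function from the
    interval to a globally continuous one, and applied to coordinates it truncates vectors. *)
Definition clamp (a b t : R) := Num.max a (Num.min b t).

Lemma clampE a b t : a <= t <= b -> clamp a b t = t.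
Proof. by rewrite /clamp => /andP[a_t tb]; rewrite min_r// max_r. Qed.

Lemma clamp_itv a b t : a <= b -> a <= clamp a b t <= b.
Proof. by move=> ab; rewrite le_max lexx/= ge_max ab ge_min lexx. Qed.

Lemma clamp_dist a b s t : `|clamp a b s - clamp a b t| <= `|s - t|.
Proof.
rewrite /clamp !(minEle, maxEle).
by case: (leP b s) => ?; case: (leP b t) => ?; case: (leP a _) => ?; try case: (leP a _) => ?;
  rewrite ler_norml; have := ler_norm (s - t); have := lerNnormlW (lexx `|s - t|); lra.
Qed.

Lemma continuous_comp_clamp n (x : R -> 'cV[R]_n) a b : a <= b ->
  {within `[a, b], continuous x} -> continuous (x \o clamp a b).
Proof.
move=> ab /enorm_within_continuousP H; apply/enorm_continuousP => t e e0.
have [|d d0 Hd] := H (clamp a b t) _ e e0; first by rewrite /= in_itv/= clamp_itv.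
exists d => // s st; apply: Hd; first by rewrite /= in_itv/= clamp_itv.
exact: le_lt_trans (clamp_dist _ _ _ _) st.
Qed.

Lemma heine n (x : R -> 'cV[R]_n) a b : continuous x ->
  forall e : R, 0 < e -> exists2 d : R, 0 < d &
    forall s t, a <= s <= b -> a <= t <= b -> `|s - t| < d -> enorm (x s - x t) <= e.
Proof.
move=> /enorm_continuousP cx e e0.
have [ba|ab] := ltP b a.
  by exists 1 => // s t /andP[/le_trans/[apply]]; rewrite leNgt ba.
pose P c := exists2 d : R, 0 < d &
    forall s t, a <= s <= c -> a <= t <= c -> `|s - t| < d -> enorm (x s - x t) <= e.
suff : P b by [].
have e2 : 0 < e / 2 by rewrite divr_gt0.
(* Gluing of two moduli: pairs in [[a, c']] use [d2]; if one point lies beyond [c'], the bound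
   [d1 / 2] on the distance puts both within [d1] of [c]. *)
have key c c' c'' d1 d2 : 0 < d1 -> 0 < d2 ->
    (forall s, `|s - c| < d1 -> enorm (x s - x c) <= e / 2) ->
    (forall s t, a <= s <= c' -> a <= t <= c' -> `|s - t| < d2 -> enorm (x s - x t) <= e) ->
    c - d1 / 2 <= c' -> c'' < c + d1 / 2 -> P c''.
  move=> d10 d20 H1 H2 cc' cc''.
  exists (Num.min d2 (d1 / 2)); first by rewrite lt_min d20 divr_gt0.
  move=> s t /andP[s1 s2] /andP[t1 t2]; rewrite lt_min => /andP[st1 st2].
  have [/andP[sc tc]|] := boolP ((s <= c') && (t <= c')).
    by apply: H2 => //; apply/andP.
  rewrite negb_and -!ltNge => st.
  move: st2; rewrite ltr_norml => /andP[st2 st3].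
  have sc : `|s - c| < d1 by rewrite ltr_norml; case/orP: st => ?; apply/andP; split; lra.
  have tc : `|t - c| < d1 by rewrite ltr_norml; case/orP: st => ?; apply/andP; split; lra.
  rewrite -[x s - x t](subrKA (x c)) (le_trans (enormD _ _))//.
  by rewrite [leRHS]splitr lerD ?H1// enorm_distC H1.
apply: (@real_induction _ P a b) => //; last by rewrite ab lexx.
- exists 1 => // s t; rewrite -!eq_le => /eqP <- /eqP <- _.
  by rewrite subrr enorm0 ltW.
- move=> t /andP[a_t tb] /(_ t); rewrite a_t lexx => /(_ isT)[d d0 Hd].
  have [d1 d10 Hd1] := cx t _ e2.
  exists (d1 / 2) => [|s /andP[ts sd] _]; first by rewrite divr_gt0.
  by apply: (key t t s d1 d) => //; rewrite lerBlDr lerDl divr_ge0// ltW.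
- move=> t /andP[a_t tb] HP.
  have [d1 d10 Hd1] := cx t _ e2.
  have [|d d0 Hd] := HP (Num.max a (t - d1 / 2)).
    by rewrite le_max lexx/= gt_max a_t ltrBlDr ltrDl divr_gt0.
  apply: (key t _ t d1 d d10 d0 Hd1 Hd); first by rewrite le_max lexx orbT.
  by rewrite ltrDl divr_gt0.
Qed.

End Continuity.

(** * States and the sup norm *)

Section SupNorm.
Context {R : realType}.
Variable Delta : R.
Hypothesis Delta_ge0 : 0 <= Delta.
Variable n : nat.
Implicit Types (phi psi x : R -> 'cV[R]_n).

(** Clamping supplies the extension. Facts about states can thus be deduced from global continuity,
    without relative topologies. *)
Lemma cstateP phi : cstate Delta n phi <->
  exists2 psi, continuous psi & forall t, - Delta <= t <= 0 -> phi t = psi t.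
Proof.
split=> [cphi|[psi cpsi phipsi]].
  exists (phi \o clamp (- Delta) 0).
    by apply: continuous_comp_clamp => //; rewrite oppr_le0.
  by move=> t tD; rewrite /= clampE.
apply/enorm_within_continuousP => t; rewrite /= in_itv/= => tD e e0.
have [d d0 Hd] := (enorm_continuousP psi).1 cpsi t e e0.
exists d => // s; rewrite /= in_itv/= => sD st.
by rewrite !phipsi ?Hd.
Qed.

Lemma continuous_cstate phi : continuous phi -> cstate Delta n phi.
Proof. by move=> cphi; apply/cstateP; exists phi. Qed.

Lemma continuous_segment x t : continuous x -> continuous (segment x t).
Proof.
move=> /enorm_continuousP cx; apply/enorm_continuousP => s e e0.
have [d d0 Hd] := cx (t + s) e e0.
by exists d => // r rs; apply: Hd; rewrite (_ : t + r - (t + s) = r - s)//; ring.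
Qed.

Lemma cstate_segment x : continuous x -> forall t, cstate Delta n (segment x t).
Proof. by move=> cx t; apply/continuous_cstate/continuous_segment. Qed.

Lemma cstateB phi psi : cstate Delta n phi -> cstate Delta n psi ->
  cstate Delta n (phi - psi).
Proof.
move=> /cstateP[p cp Hp] /cstateP[q cq Hq]; apply/cstateP; exists (p - q).
  by move=> t; apply: cvgB; [exact: cp|exact: cq].
by move=> t tD; rewrite !fctE Hp ?Hq.
Qed.

Lemma continuous_bounded x a b : continuous x ->
  exists2 M, 0 <= M & forall t, a <= t <= b -> enorm (x t) <= M.
Proof.
move=> cx; have /compact_bounded : compact (x @` `[a, b]).
  apply: continuous_compact; first exact: continuous_subspaceT.
  exact: segment_compact.
move=> [M [_ HM]]; exists (n%:R * (`|M| + 1)); first by rewrite mulr_ge0// addr_ge0.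
move=> t tab; rewrite (le_trans (enorm_le_mx_norm _))// ler_wpM2l//.
apply: HM; first by rewrite (le_lt_trans (ler_norm _))// ltrDl.
by exists t => //=; rewrite in_itv/= tab.
Qed.

Lemma supnorm_ub phi t : cstate Delta n phi -> - Delta <= t <= 0 ->
  enorm (phi t) <= supnorm Delta phi.
Proof.
move=> /cstateP[psi cpsi phipsi] tD; apply: ub_le_sup; last first.
  by exists t => //=; rewrite in_itv.
have [M _ HM] := continuous_bounded (- Delta) 0 cpsi.
by exists M => _ [s + <-]; rewrite /= in_itv/= => sD; rewrite phipsi// HM.
Qed.

Lemma supnorm_le phi r :
  (forall t, - Delta <= t <= 0 -> enorm (phi t) <= r) -> supnorm Delta phi <= r.
Proof.
move=> H; apply: ge_sup.
  by exists (enorm (phi 0)), 0 => //=; rewrite in_itv/= lexx oppr_le0 Delta_ge0.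
by move=> _ [s + <-]; rewrite /= in_itv/=; exact: H.
Qed.

Lemma window0 : - Delta <= (0 : R) <= 0.
Proof. by rewrite lexx oppr_le0 Delta_ge0. Qed.

Lemma supnorm_ge0 phi : cstate Delta n phi -> 0 <= supnorm Delta phi.
Proof. by move=> /supnorm_ub/(_ window0); apply: le_trans; exact: enorm_ge0. Qed.

Lemma eq_supnorm phi psi : (forall t, - Delta <= t <= 0 -> phi t = psi t) ->
  supnorm Delta phi = supnorm Delta psi.
Proof.
move=> H; congr sup; apply/seteqP; split=> _ [t tD <-]; exists t => //.
  by rewrite H//; move: tD; rewrite /= in_itv.
by rewrite H//; move: tD; rewrite /= in_itv.
Qed.

Lemma supnorm0 phi : (forall t, - Delta <= t <= 0 -> phi t = 0) ->
  supnorm Delta phi = 0.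
Proof.
move=> H; apply/eqP; rewrite eq_le; apply/andP; split.
  by apply: supnorm_le => t /H ->; rewrite enorm0.
apply: supnorm_ge0; apply/cstateP; exists (fun=> 0) => //.
exact: cst_continuous.
Qed.

(** The Lipschitz condition on the bounded set made of [(phi, v)] and [(psi, v)], which are at sup
    distance zero, forces equal values. *)
Lemma eq_f m (f : (R -> 'cV[R]_n) -> 'cV[R]_m -> 'cV[R]_n) phi psi v :
  lipschitz_bounded_f Delta f -> cstate Delta n phi -> cstate Delta n psi ->
  (forall t, - Delta <= t <= 0 -> phi t = psi t) -> f phi v = f psi v.
Proof.
move=> Lf cphi cpsi E.
have [||L HL] := Lf [set p | (p.1 = phi \/ p.1 = psi) /\ p.2 = v].
- by move=> p [[->|->] _].
- exists (supnorm Delta phi + enorm v) => p [[->|->] ->] //.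
  by rewrite (eq_supnorm E).
have := HL (phi, v) (psi, v) (conj (or_introl erefl) erefl) (conj (or_intror erefl) erefl).
rewrite /= subrr enorm0 supnorm0; last by move=> t tD; rewrite !fctE E// subrr.
by rewrite addr0 mulr0 => /enorm_eq0/eqP; rewrite subr_eq0 => /eqP.
Qed.

End SupNorm.

Arguments cstate_segment {R Delta} Delta_ge0 {n x} cx t.

(** * Comparison lemmas with exceptional null sets *)

Section Comparison.
Context {R : realType}.
Notation mu := (@lebesgue_measure R).

(** Increments are compared, not derivatives, so [chi] may jump: monotonicity of [chi] and the
    absence of upward jumps of [w] suffice to pass to a limit from the left. This freedom lets [chi]
    carry the growth of [w] on a null set. *)
Lemma monotone_comparison (w chi : R -> R) (a b : R) : a <= b ->
  (forall s t, a <= s -> s <= t -> t <= b -> chi s <= chi t) ->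
  (forall t, a < t <= b -> forall e : R, 0 < e -> exists2 d : R, 0 < d &
     forall s, a <= s < t -> t - d < s -> w t <= w s + e) ->
  (forall t, a <= t < b -> exists2 d : R, 0 < d &
     forall h, 0 < h < d -> t + h <= b -> w (t + h) - w t <= chi (t + h) - chi t) ->
  w b - w a <= chi b - chi a.
Proof.
move=> ab chi_nd w_left w_right.
pose P t := w t - w a <= chi t - chi a.
apply: (@real_induction R P a b); last by rewrite ab lexx.
- by rewrite /P !subrr.
- move=> t /andP[a_t tb] /(_ t); rewrite a_t lexx => /(_ isT) Pt.
  have [|d d0 Hd] := w_right t; first by rewrite a_t.
  exists d => // s /andP[ts std] sb; have := Hd (s - t).
  rewrite subr_gt0 ts ltrBlDl std addrC subrK sb => /(_ isT isT).
  by move: Pt; rewrite /P; lra.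
- move=> t /andP[a_t tb] HP; rewrite /P; apply/ler_addgt0Pr => e e0.
  have [|d d0 Hd] := w_left t _ e e0; first by rewrite a_t.
  pose s := Num.max a (t - d / 2).
  have sa : a <= s by rewrite le_max lexx.
  have st : s < t by rewrite gt_max a_t ltrBlDr ltrDl divr_gt0.
  have /Hd : a <= s < t by rewrite sa.
  have -> : t - d < s.
    by rewrite lt_max ltrD2l ltrN2 ltr_pdivrMr// mulr_natr mulr2n ltrDl d0 orbT.
  move=> /(_ isT); have := HP s; rewrite /P sa st => /(_ isT).
  by have := chi_nd s t sa (ltW st) tb; lra.
Qed.

(* The variation of [z] over finite families of intervals inside an open set of
   small measure that contains [N]. *)
Lemma null_cover_variation n (z : R -> 'cV[R]_n) (b e : R) (N : set R) :
  absolutely_continuous 0 b z -> mu.-negligible N -> 0 < e ->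
  exists chi : R -> R,
    [/\ forall s t, 0 <= s -> s <= t -> t <= b -> chi s <= chi t,
        forall t, 0 <= t <= b -> 0 <= chi t <= e &
        forall t, N t -> 0 <= t < b -> exists2 d : R, 0 < d &
          forall h, 0 < h < d -> t + h <= b ->
            enorm (z (t + h) - z t) <= chi (t + h) - chi t].
Proof.
move=> acz negN e0; have [d d0 Hd] := acz e e0.
have d2 : 0 < d / 2 by rewrite divr_gt0.
have [U [oU NU mU]] := outer_measure_open_le N d2.
have {}mU : (mu U <= (d / 2)%:E)%E.
  by move: mU; rewrite (negligible_outer_measure N).1// add0e.
pose fam (t : R) (M : nat) (p q : 'I_M -> R) :=
  [/\ forall i, 0 <= p i <= q i /\ q i <= t,
      forall i j, i != j -> q i <= p j \/ q j <= p i &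
      forall i r, p i <= r <= q i -> U r].
pose S t : set R := [set v | exists M (p q : 'I_M -> R), fam t M p q /\
  v = \sum_i enorm (z (q i) - z (p i))].
have S0 t : S t 0.
  exists 0%N, (fun=> 0), (fun=> 0); split; last by rewrite big_ord0.
  by split; case.
have Se t : t <= b -> ubound (S t) e.
  move=> tb _ [M [p [q [[H1 H2 H3] ->]]]]; apply/ltW/Hd => //.
    by move=> i; have [-> qt] := H1 i; rewrite (le_trans qt).
  (* Half-open, so that intervals sharing an endpoint are still disjoint; their total length is then
     at most [mu U <= d / 2], and absolute continuity bounds the variation by [e]. *)
  pose F i : set R := `]p i, q i]%classic.
  have mF i : measurable (F i) by exact: measurable_itv.
  have FU : \big[setU/set0]_(i < M) F i `<=` U.
    apply: (big_ind (fun X => X `<=` U)) => [|X Y XU YU|i _]; first exact: sub0set.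
      by rewrite subUset.
    move=> r; rewrite /F/= in_itv/= => /andP[/ltW r1 r2].
    by apply: (H3 i); rewrite r1.
  have trF : trivIset setT F.
    apply/trivIsetP => i j _ _ /H2 ij; apply/seteqP; split => // r [].
    rewrite /F/= !in_itv/= => /andP[r1 r2] /andP[r3 r4].
    by case: ij => /= ?; lra.
  have mUF : measurable (\big[setU/set0]_(i < M) F i) by exact: bigsetU_measurable.
  rewrite -lte_fin; apply: le_lt_trans (_ : (d / 2)%:E < _)%E; last first.
    by rewrite lte_fin ltr_pdivrMr// mulr_natr mulr2n ltrDl.
  apply: le_trans mU; rewrite -sumEFin.
  rewrite (eq_bigr (fun i => mu (F i))); last first.
    move=> i _; rewrite lebesgue_measure_itv/= lte_fin -EFinB.
    have [/andP[_]] := H1 i; rewrite le_eqVlt => /predU1P[->|->]//.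
    by rewrite ltxx subrr.
  rewrite -(measure_semi_additive_ord mu mF trF mUF).
  by apply: le_measure; rewrite ?inE//; exact: open_measurable.
have supS t : t <= b -> has_sup (S t).
  by move=> tb; split; [exists 0; exact: S0|exists e; exact: Se].
exists (fun t => sup (S t)); split.
- move=> s t s0 st tb; apply: sup_le.
  + move=> v [M [p [q [[H1 H2 H3] ->]]]]; exists (\sum_i enorm (z (q i) - z (p i))); split=> //.
    exists M, p, q; split => //; split => // i.
    by have [-> qs] := H1 i; rewrite (le_trans qs).
  + by exists 0; exact: S0.
  + exact: supS.
- move=> t /andP[t0 tb]; apply/andP; split.
    by apply: ub_le_sup; [case: (supS t tb)|exact: S0].
  by apply: ge_sup; [exists 0; exact: S0|exact: Se].
(* Near a point of [N] the whole interval [[t, t + h]] lies in [U], so it can be appended to any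
   family below [t]; the supremum grows by at least the increment of [z]. *)
- move=> t /NU Ut /andP[t0 tb].
  have /nbhs_ballP[d1 /= d10 Hd1] := open_nbhs_nbhs (conj oU Ut).
  exists d1 => // h /andP[h0 hd1] thb.
  rewrite lerBrDr; set v := enorm _.
  rewrite addrC -lerBrDr; apply: ge_sup; first by exists 0; exact: S0.
  move=> _ [M [p [q [[H1 H2 H3] ->]]]]; rewrite lerBrDr.
  apply: ub_le_sup; first by case: (supS (t + h) thb).
  pose p' (i : 'I_M.+1) := if unlift ord0 i is Some j then p j else t.
  pose q' (i : 'I_M.+1) := if unlift ord0 i is Some j then q j else t + h.
  exists M.+1, p', q'; split; last first.
    rewrite big_ord_recl /p' /q' unlift_none addrC; congr (_ + _).
    by apply: eq_bigr => i _; rewrite liftK.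
  split.
  + move=> i; rewrite /p' /q'; case: unliftP => [j _|_].
      by have [-> qt] := H1 j; split=> //; rewrite (le_trans qt)// lerDl ltW.
    by rewrite t0 lerDl ltW.
  + move=> i j; rewrite /p' /q'; case: unliftP => [i' ->|->]; case: unliftP => [j' ->|->].
    * by rewrite (inj_eq (@lift_inj _ _)); exact: H2.
    * by move=> _; left; case: (H1 i').
    * by move=> _; right; case: (H1 j').
    * by rewrite eqxx.
  + move=> i r; rewrite /p' /q'; case: unliftP => [j _|_]; first exact: H3.
    move=> /andP[r1 r2]; apply: Hd1; rewrite /ball/= ltr_norml; apply/andP; split; lra.
Qed.

Lemma absolutely_continuousS n (z : R -> 'cV[R]_n) (a b c : R) :
  c <= b -> absolutely_continuous a b z -> absolutely_continuous a c z.
Proof.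
move=> cb H e /H[d d0 Hd]; exists d => // N s t st; apply: Hd => i.
by have [-> tc] := st i; rewrite (le_trans tc).
Qed.

Lemma absolutely_continuous_cont n (z : R -> 'cV[R]_n) (a b : R) :
  absolutely_continuous a b z -> forall e : R, 0 < e -> exists2 d : R, 0 < d &
    forall s t, a <= s -> s <= t -> t <= b -> t - s < d -> enorm (z t - z s) <= e.
Proof.
move=> H e /H[d d0 Hd]; exists d => // s t as_ st tb std.
have := Hd 1%N (fun=> s) (fun=> t); rewrite !big_ord1 => /(_ _ _ std) Hst.
apply/ltW/Hst; first by move=> _; rewrite as_ st.
by move=> i j; rewrite !ord1.
Qed.

Lemma lipschitz_absolutely_continuous n (z : R -> 'cV[R]_n) (a b L : R) :
  (forall s t, a <= s -> s <= t -> t <= b -> enorm (z t - z s) <= L * (t - s)) ->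
  absolutely_continuous a b z.
Proof.
move=> H e e0; exists (e / (`|L| + 1)); first by rewrite divr_gt0// ltr_wpDl.
move=> N s t st _ sumd.
apply: (@le_lt_trans _ _ ((`|L| + 1) * \sum_i (t i - s i))); last first.
  by move: sumd; rewrite ltr_pdivlMr ?ltr_wpDl// mulrC.
rewrite mulr_sumr ler_sum// => i _; have [/andP[as_ sti] tb] := st i.
apply: (le_trans (H _ _ as_ sti tb)); rewrite ler_wpM2r ?subr_ge0//.
by rewrite (le_trans (ler_norm L))// lerDl.
Qed.

(** The cover function [chi] of the identity has slope at least 1 at the points of [N]. Hence
    [K * chi] absorbs the excess of [C] over [k] there, and its total growth is at most [e / 2].
    Absolute continuity of [w] is replaced by left continuity. *)
Lemma dini_le (w : R -> R) (a b k C : R) (N : set R) : 0 <= a -> a <= b ->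
  mu.-negligible N ->
  (forall t, a < t <= b -> forall e : R, 0 < e -> exists2 d : R, 0 < d &
     forall s, a <= s < t -> t - d < s -> `|w t - w s| <= e) ->
  (forall t, a <= t < b -> ~ N t -> forall e : R, 0 < e -> exists2 d : R, 0 < d &
     forall h, 0 < h < d -> t + h <= b -> w (t + h) - w t <= (k + e) * h) ->
  (forall t, a <= t < b -> exists2 d : R, 0 < d &
     forall h, 0 < h < d -> t + h <= b -> w (t + h) - w t <= C * h) ->
  w b - w a <= k * (b - a).
Proof.
move=> a0 ab negN w_left w_ae w_all; apply/ler_addgt0Pr => e e0.
pose id1 (t : R) : 'cV[R]_1 := const_mx t.
have idE s t : enorm (id1 s - id1 t) = `|s - t|.
  by rewrite -enorm_cst1; congr enorm; apply/matrixP => i j; rewrite !mxE.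
have ac_id : absolutely_continuous 0 b id1.
  apply: (@lipschitz_absolutely_continuous _ _ _ _ 1) => s t _ st _.
  by rewrite idE mul1r ger0_norm// subr_ge0.
pose K := `|C| + `|k| + 1.
have K0 : 0 < K by rewrite ltr_wpDl// addr_ge0.
pose e1 := e / 2 / (b - a + 1).
have ba0 : 0 < b - a + 1 by rewrite ltr_wpDl// subr_ge0.
have e10 : 0 < e1 by rewrite !divr_gt0.
have eK : 0 < e / 2 / K by rewrite !divr_gt0.
have [chi [chi_nd chi_e chi_N]] := null_cover_variation ac_id negN eK.
have : (w b - (k + e1) * b) - (w a - (k + e1) * a) <= K * chi b - K * chi a.
  apply: (@monotone_comparison (fun t => w t - (k + e1) * t) (fun t => K * chi t) a b) => //.
  - move=> s t as_ st tb; rewrite ler_pM2l// chi_nd// (le_trans a0)//.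
  - move=> t at_ r r0; have r2 : 0 < r / 2 by rewrite divr_gt0.
    have [d d0 Hd] := w_left t at_ _ r2.
    have k10 : 0 < `|k + e1| + 1 by rewrite ltr_wpDl.
    have q0 : 0 < r / 2 / (`|k + e1| + 1) by rewrite divr_gt0.
    exists (Num.min d (r / 2 / (`|k + e1| + 1))); first by rewrite lt_min d0.
    move=> s ast tds.
    have ds : t - d < s by apply: le_lt_trans tds; rewrite lerD2l lerN2 ge_min lexx.
    have : t - r / 2 / (`|k + e1| + 1) < s.
      by apply: le_lt_trans tds; rewrite lerD2l lerN2 ge_min lexx orbT.
    rewrite ltrBlDr -ltrBlDl ltr_pdivlMr// => tsk.
    have := Hd s ast ds; rewrite ler_norml => /andP[_ H1].
    have := ler_norm (- (k + e1)); rewrite normrN => H2.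
    have ts : 0 <= t - s by rewrite subr_ge0 ltW//; case/andP: ast.
    have := ler_wpM2l ts H2.
    by nra.
  - move=> t /andP[a_t tb]; have tab : a <= t < b by rewrite a_t.
    have t0b : 0 <= t < b by rewrite (le_trans a0).
    have [Nt|nNt] := pselect (N t).
      have [d1 d10 Hd1] := w_all t tab; have [d2 d20 Hd2] := chi_N t Nt t0b.
      exists (Num.min d1 d2) => [|h]; first by rewrite lt_min d10.
      rewrite lt_min => /and3P[h0 hd1 hd2] thb.
      have := Hd1 h; rewrite h0 hd1 => /(_ isT thb) H1.
      have := Hd2 h; rewrite h0 hd2 => /(_ isT thb).
      rewrite idE addrAC subrr add0r gtr0_norm// => H2.
      have H3 : K * h <= K * (chi (t + h) - chi t) by rewrite ler_pM2l.
      have H4 : C * h <= `|C| * h by rewrite ler_wpM2r ?ler_norm// ltW.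
      have H5 : - k * h <= `|k| * h by rewrite ler_wpM2r ?(ltW h0)// -normrN ler_norm.
      have H6 : 0 < e1 * h by rewrite mulr_gt0.
      by move: H1 H3 H4 H5 H6; rewrite /K; nra.
    have [d d0 Hd] := w_ae t tab nNt e1 e10.
    exists d => // h hd thb; have H1 := Hd h hd thb.
    have : chi t <= chi (t + h).
      by apply: chi_nd => //; [rewrite (le_trans a0)|rewrite lerDl ltW//; case/andP: hd].
    by rewrite -subr_ge0 -(pmulr_rge0 _ K0) => H2; lra.
have /chi_e/andP[_ chib] : 0 <= b <= b by rewrite lexx (le_trans a0).
have /chi_e/andP[chia _] : 0 <= a <= b by rewrite a0 ab.
have H1 : K * chi b <= e / 2 by rewrite mulrC -ler_pdivlMr.
have H2 : 0 <= K * chi a by rewrite mulr_ge0// ltW.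
have H3 : e1 * (b - a) <= e / 2.
  by rewrite /e1 mulrAC ler_pdivrMr// ler_wpM2l ?lerDl// divr_ge0// ltW.
by move: H1 H2 H3; lra.
Qed.

(** No bound on difference quotients is available on [N]; there the cover function of [z] itself
    dominates its increments, at total cost [e / 2]. *)
Lemma absolutely_continuous_le n (z : R -> 'cV[R]_n) (G : R -> R) (a b : R) (N : set R) :
  0 <= a -> a <= b -> absolutely_continuous 0 b z -> mu.-negligible N ->
  (forall s t, a <= s -> s <= t -> t <= b -> G s <= G t) ->
  (forall t, a <= t < b -> ~ N t -> forall e : R, 0 < e -> exists2 d : R, 0 < d &
     forall h, 0 < h < d -> t + h <= b ->
       enorm (z (t + h) - z t) <= G (t + h) - G t + e * h) ->
  enorm (z b - z a) <= G b - G a.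
Proof.
move=> a0 ab acz negN G_nd z_ae; apply/ler_addgt0Pr => e e0.
pose e1 := e / 2 / (b - a + 1).
have ba0 : 0 < b - a + 1 by rewrite ltr_wpDl// subr_ge0.
have e10 : 0 < e1 by rewrite !divr_gt0.
have e2 : 0 < e / 2 by rewrite divr_gt0.
have [chi [chi_nd chi_e chi_N]] := null_cover_variation acz negN e2.
pose w t := enorm (z t - z a); pose g t := G t + e1 * t + chi t.
have : w b - w a <= g b - g a.
  have wle s t : w t - w s <= enorm (z t - z s).
    by rewrite lerBlDr /w -[z t - z a](subrKA (z s)) enormD.
  have g_nd s t : a <= s -> s <= t -> t <= b ->
      0 <= G t - G s /\ 0 <= e1 * (t - s) /\ 0 <= chi t - chi s.
    move=> as_ st tb; split; first by rewrite subr_ge0 G_nd.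
    split; first by rewrite mulr_ge0 ?subr_ge0// ltW.
    by rewrite subr_ge0 chi_nd// (le_trans a0).
  apply: monotone_comparison => //.
  - move=> s t as_ st tb; have := g_nd s t as_ st tb.
    by rewrite /g => -[? [? ?]]; lra.
  - move=> t /andP[a_t tb] r r0; have [d d0 Hd] := absolutely_continuous_cont acz r0.
    exists d => // s /andP[as_ st] tds; rewrite addrC -lerBlDr (le_trans (wle _ _))//.
    by apply: Hd; rewrite ?(le_trans a0)// ?(ltW st)// ltrBlDl -ltrBlDr.
  - move=> t /andP[a_t tb]; have tab : a <= t < b by rewrite a_t.
    have t0b : 0 <= t < b by rewrite (le_trans a0).
    have [Nt|nNt] := pselect (N t).
      have [d d0 Hd] := chi_N t Nt t0b.
      exists d => // h hd thb; have := Hd h hd thb.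
      have := wle t (t + h); have := g_nd t (t + h) a_t _ thb.
      rewrite lerDl ltW; last by case/andP: hd.
      by move=> /(_ isT)[? [? ?]]; rewrite /g; lra.
    have [d d0 Hd] := z_ae t tab nNt e1 e10.
    exists d => // h hd thb; have := Hd h hd thb.
    have := wle t (t + h); have := g_nd t (t + h) a_t _ thb.
    rewrite lerDl ltW; last by case/andP: hd.
    by move=> /(_ isT)[? [? ?]]; rewrite /g; lra.
rewrite /w subrr enorm0 subr0 /g => H.
have /chi_e/andP[_ chib] : 0 <= b <= b by rewrite lexx (le_trans a0).
have /chi_e/andP[chia _] : 0 <= a <= b by rewrite a0 ab.
have H3 : e1 * (b - a) <= e / 2.
  by rewrite /e1 mulrAC ler_pdivrMr// ler_wpM2l ?lerDl// divr_ge0// ltW.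
by move: H H3; lra.
Qed.

End Comparison.

(** * Exponential decay from the integrated inequalities *)

Section Contraction.
Context {R : realType}.

(* [e] stands for [|x|^2], [E] for [||x_t||^2], [v] for [V(x_t)] and [p] for
   [x^T P x] along a trajectory on [[0, b]]; [g] bounds [gamma(|u|)]. *)
Record dissipative (Delta alow aup a sigma pmin pmax c g b : R)
    (e E v p : R -> R) : Prop := Dissipative {
  diss_ge0 : forall t : R, 0 <= e t ;
  diss_win : forall t s : R, 0 <= t <= b -> t - Delta <= s <= t -> e s <= E t ;
  diss_win_le : forall t M : R, 0 <= t <= b ->
    (forall s : R, t - Delta <= s <= t -> e s <= M) -> E t <= M ;
  diss_bounded : exists M : R, forall t : R, - Delta <= t <= b -> e t <= M ;
  diss_v : forall t : R, 0 <= t <= b -> alow * e t <= v t <= aup * E t ;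
  diss_p : forall t : R, 0 <= t <= b -> pmin * e t <= p t <= pmax * e t ;
  diss_v_le : forall s t k : R, 0 <= s -> s <= t -> t <= b ->
    (forall r : R, s <= r <= t -> - a * e r + c * E r + g <= k) ->
    v t - v s <= k * (t - s) ;
  diss_p_ge : forall s t k : R, 0 <= s -> s <= t -> t <= b ->
    (forall r : R, s <= r <= t -> sigma * (E r + g) <= k) ->
    - (k * (t - s)) <= p t - p s }.

Variables (Delta alow aup a sigma pmin pmax : R).
Hypotheses (Delta0 : 0 <= Delta) (alow0 : 0 < alow) (alow_aup : alow <= aup).
Hypotheses (a0 : 0 < a) (sigma0 : 0 < sigma) (pmin0 : 0 < pmin) (pmax0 : 0 < pmax).

Let aup0 : 0 < aup := lt_le_trans alow0 alow_aup.

(** Let [X] be the supremum of [e] on the window and the horizon. From [alow * e r <= v r <= v s +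
    (c * X + g) * T], the condition [2 * c * T <= alow] absorbs the term in [c] into [X / 2];
    boundedness of [e] makes [X] finite, so it can be moved across. *)
Lemma dissipative_window_le (T c g b : R) (e E v p : R -> R) :
  dissipative Delta alow aup a sigma pmin pmax c g b e E v p ->
  0 <= T -> 0 <= c -> 0 <= g -> 2 * c * T <= alow ->
  forall s t : R, 0 <= s -> s <= t -> t <= b -> t <= s + T ->
  forall r : R, s - Delta <= r <= t ->
    e r <= 2 * aup / alow * E s + 2 * T / alow * g.
Proof.
move=> H T0 c0 g0 cT s t s0 st tb tsT.
pose S := [set e r | r in [set r | s - Delta <= r <= t]].
have Ss : S (e s) by exists s => //=; rewrite st lerBlDr lerDl Delta0.
have sb : 0 <= s <= b by rewrite s0 (le_trans st).
have supS : has_sup S.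
  split; first by exists (e s).
  have [M HM] := diss_bounded H; exists M => _ [r /= /andP[r1 r2] <-].
  by apply: HM; apply/andP; split; lra.
pose X := sup S.
have eX r : s - Delta <= r <= t -> e r <= X.
  by move=> rs; apply: ub_le_sup; [case: supS|exists r].
pose Y := aup / alow * E s + T / alow * g.
have Es0 : 0 <= E s.
  by apply: le_trans (diss_ge0 H s) (diss_win H sb _); rewrite lerBlDr lerDl Delta0 lexx.
have X0 : 0 <= X by apply: le_trans (diss_ge0 H s) (eX s _); rewrite st lerBlDr lerDl Delta0.
have XY : X <= Y + X / 2.
  apply: ge_sup; first by exists (e s).
  move=> _ [r /= /andP[r1 r2] <-].
  have [rs|sr] := leP r s.
    have H1 : e r <= E s by apply: (diss_win H sb); rewrite r1.
    have H2 : E s <= aup / alow * E s by rewrite ler_peMl// ler_pdivlMr// mul1r.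
    have H3 : 0 <= T / alow * g by rewrite mulr_ge0// divr_ge0// ltW.
    by rewrite /Y; lra.
  have rb : 0 <= r <= b by apply/andP; split; lra.
  have /andP[vr _] := diss_v H rb.
  have /andP[_ vs] := diss_v H sb.
  have := @diss_v_le _ _ _ _ _ _ _ _ _ _ _ _ _ _ H s r (c * X + g) s0 (ltW sr).
  have -> : r <= b by lra.
  move=> /(_ isT) H1.
  have {}H1 : v r - v s <= (c * X + g) * (r - s).
    apply: H1 => q /andP[q1 q2].
    have Eq : E q <= X.
      apply: (diss_win_le H); first by apply/andP; split; lra.
      by move=> q' /andP[? ?]; apply: eX; apply/andP; split; lra.
    have := mulr_ge0 (ltW a0) (diss_ge0 H q); have := ler_wpM2l c0 Eq; lra.
  have cXg : 0 <= c * X + g by rewrite addr_ge0// mulr_ge0.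
  have H2 : (c * X + g) * (r - s) <= (c * X + g) * T by rewrite ler_wpM2l//; lra.
  have H3 : 2 * c * T * X <= alow * X by rewrite ler_wpM2r.
  have H4 : e r * alow <= aup * E s + (c * X + g) * T by lra.
  rewrite -ler_pdivlMr// in H4; apply: (le_trans H4).
  have -> : Y + X / 2 = (aup * E s + T * g + alow * X / 2) / alow.
    by rewrite /Y; field; rewrite gt_eqF.
  by rewrite ler_pM2r ?invr_gt0//; lra.
move=> r rst; apply: (le_trans (eX r rst)).
have -> : 2 * aup / alow * E s + 2 * T / alow * g = 2 * Y by rewrite /Y; ring.
by lra.
Qed.

Lemma dissipative_v_incr (X c g b x y : R) (e E v p : R -> R) :
  dissipative Delta alow aup a sigma pmin pmax c g b e E v p ->
  0 <= c -> 0 <= x -> x <= y -> y <= b -> (forall z : R, x <= z <= y -> E z <= X) ->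
  v y - v x <= (c * X + g) * (y - x).
Proof.
move=> H c0 x0 xy yb EX; apply: (diss_v_le H x0 xy yb) => z /EX Ez.
by have := mulr_ge0 (ltW a0) (diss_ge0 H z); have := ler_wpM2l c0 Ez; lra.
Qed.

(** [p] falls at rate at most [sigma * K * Z], hence by at most [ep * Z / 2] during time [r]. So [e]
    stays above [ep * Z / (2 * pmax)], and the dissipation of [v] acts at that level. *)
Lemma dissipative_drop (K X Z ep r c g b t : R) (e E v p : R -> R) :
  dissipative Delta alow aup a sigma pmin pmax c g b e E v p ->
  0 <= c -> 0 <= K -> 0 < r -> 0 <= Z -> 2 * (sigma * K) * r <= ep ->
  X + g <= K * Z -> 0 <= t -> t + r <= b ->
  (forall z : R, t <= z <= t + r -> E z <= X) -> ep * Z < p t ->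
  v (t + r) - v t <= (c * X + g) * r - a * (ep * Z / (2 * pmax)) * r.
Proof.
move=> H c0 K0 r0 Z0 rK XgZ t0 trb EX pt.
have := diss_v_le H (s := t) (t := t + r) (k := c * X + g - a * (ep * Z / (2 * pmax))) t0.
rewrite lerDl (ltW r0) [t + r - t]addrC addKr -mulrBl => /(_ isT trb); apply.
move=> z /andP[tz zt].
have zb : 0 <= z <= b by rewrite (le_trans t0 tz) (le_trans zt trb).
have Ez : E z <= X by apply: EX; rewrite tz zt.
have pz : - (sigma * (K * Z) * (z - t)) <= p z - p t.
  apply: (diss_p_ge H t0 tz); first by case/andP: zb.
  move=> y /andP[ty yz]; rewrite ler_pM2l//; apply: le_trans XgZ.
  by rewrite lerD2r EX// ty (le_trans yz zt).
have zr : z - t <= r by rewrite lerBlDl.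
have /andP[_ pe] := diss_p H zb.
have ez : ep * Z / (2 * pmax) <= e z.
  rewrite ler_pdivrMr ?mulr_gt0//.
  have B1 : sigma * (K * Z) * (z - t) <= sigma * (K * Z) * r.
    by rewrite ler_wpM2l// mulr_ge0 ?mulr_ge0// ltW.
  have B2 := ler_wpM2r Z0 rK.
  by move: pe pz pt B1 B2; lra.
have := ler_wpM2l (ltW a0) ez; have := ler_wpM2l c0 Ez; lra.
Qed.

(** Time is cut into slots of length [Delta + 1]: a window, followed by room for a drop of duration
    [r <= 1] starting inside it, so that drops of different slots do not overlap. If every window
    had a time with large [p], the [N] drops would exceed the total [2 * aup * Z] available to
    [v]. *)
Lemma dissipative_small_window (N : nat) (K X Z ep r c g b s : R) (e E v p : R -> R) :
  dissipative Delta alow aup a sigma pmin pmax c g b e E v p ->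
  0 <= c -> 0 <= s -> s + N%:R * (Delta + 1) <= b ->
  0 <= K -> 0 < r <= 1 -> 2 * (sigma * K) * r <= ep ->
  4 * aup * pmax < N%:R * (a * ep * r) ->
  (forall z : R, s <= z <= s + N%:R * (Delta + 1) -> E z <= X) ->
  0 < Z -> X + g <= K * Z ->
  aup * E s + (c * X + g) * (N%:R * (Delta + 1)) <= 2 * aup * Z ->
  exists j : nat, (j < N)%N /\ forall t : R,
    s + j%:R * (Delta + 1) <= t <= s + j%:R * (Delta + 1) + Delta -> p t <= ep * Z.
Proof.
move=> H c0 s0 sb K0 /andP[r0 r1] rK NH EX Z0 XgZ budget.
have LS j : j.+1%:R * (Delta + 1) = j%:R * (Delta + 1) + Delta + 1 by rewrite -natr1; ring.
have L0 : 0 <= Delta + 1 by rewrite addr_ge0.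
apply: contrapT => nH.
(* Each slot splits into growth up to [t], a drop on [[t, t + r]], and growth to its end. *)
have dec j : (j <= N)%N -> v (s + j%:R * (Delta + 1)) <=
    v s + (c * X + g) * (j%:R * (Delta + 1)) - j%:R * (a * (ep * Z / (2 * pmax)) * r).
  elim: j => [_|j IH jN]; first by rewrite !mul0r mulr0 addr0 addr0 subr0.
  have {IH} IHj := IH (ltnW jN).
  have [t /andP[t1 t2] pt] : exists2 t : R,
      s + j%:R * (Delta + 1) <= t <= s + j%:R * (Delta + 1) + Delta & ep * Z < p t.
    apply: contrapT => nt; apply: nH; exists j; split => // t tj.
    by rewrite leNgt; apply/negP => pt; apply: nt; exists t.
  have jN' : j.+1%:R * (Delta + 1) <= N%:R * (Delta + 1) by rewrite ler_wpM2r// ler_nat.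
  have [q qE] : exists q : R, q = j%:R * (Delta + 1) by exists (j%:R * (Delta + 1)).
  have q0 : 0 <= q by rewrite qE mulr_ge0.
  clear nH NH budget; rewrite LS -qE in jN'; rewrite LS -qE -natr1.
  rewrite -qE in IHj t1 t2; clear qE.
  have sq : s <= s + q by rewrite lerDl.
  have x0 : 0 <= s + q by rewrite addr_ge0.
  have t0 : 0 <= t by exact: le_trans t1.
  have trq : t + r <= s + (q + Delta + 1) by rewrite !addrA lerD.
  have qT : s + (q + Delta + 1) <= s + N%:R * (Delta + 1) by rewrite lerD2l.
  have qb : s + (q + Delta + 1) <= b by exact: le_trans sb.
  have trb : t + r <= b by exact: le_trans qb.
  have tr : t <= t + r by rewrite lerDl ltW.
  have EX' z : s + q <= z -> z <= s + (q + Delta + 1) -> E z <= X.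
    by move=> z1 z2; apply: EX; rewrite (le_trans sq z1) (le_trans z2 qT).
  have I1 : v t - v (s + q) <= (c * X + g) * (t - (s + q)).
    apply: (dissipative_v_incr H c0 x0 t1); first exact: le_trans trb.
    move=> z /andP[z1 z2]; apply: EX' => //; apply: (le_trans z2).
    exact: (le_trans tr).
  have I3 : v (s + (q + Delta + 1)) - v (t + r) <=
      (c * X + g) * (s + (q + Delta + 1) - (t + r)).
    apply: (dissipative_v_incr H c0 _ trq qb); first exact: le_trans tr.
    by move=> z /andP[z1 z2]; apply: EX' => //; rewrite (le_trans t1)// (le_trans tr).
  have I2 : v (t + r) - v t <= (c * X + g) * r - a * (ep * Z / (2 * pmax)) * r.
    apply: (dissipative_drop H c0 K0 r0 (ltW Z0) rK XgZ t0 trb _ pt).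
    by move=> z /andP[z1 z2]; apply: EX'; [exact: le_trans z1|exact: le_trans trq].
  by move: IHj I1 I2 I3; lra.
have := dec N (leqnn N).
have T0 : 0 <= N%:R * (Delta + 1) by rewrite mulr_ge0.
have vT : 0 <= v (s + N%:R * (Delta + 1)).
  have /(diss_v H)/andP[+ _] : 0 <= s + N%:R * (Delta + 1) <= b by rewrite addr_ge0.
  by apply: le_trans; rewrite mulr_ge0 ?(ltW alow0)// (diss_ge0 H).
have /(diss_v H)/andP[_ vs] : 0 <= s <= b by rewrite s0 (le_trans _ sb)// lerDl.
have NZ : 2 * aup * Z < N%:R * (a * (ep * Z / (2 * pmax)) * r).
  have -> : N%:R * (a * (ep * Z / (2 * pmax)) * r) = N%:R * (a * ep * r) * Z / (2 * pmax) by ring.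
  rewrite ltr_pdivlMr ?mulr_gt0//.
  have -> : 2 * aup * Z * (2 * pmax) = 4 * aup * pmax * Z by ring.
  by rewrite ltr_pM2r.
by move: vT vs NZ budget; lra.
Qed.

(* The horizon [T] is taken so long that on one of the windows of length
   [Delta] inside it [p] stays below a small multiple of [E s + G * g]:
   otherwise the growth bound on [p] keeps [e] large after each of the [N]
   spaced times, and [v] would become negative. *)
Lemma dissipative_halving : exists T Ga : R, [/\ 0 < T, 0 <= Ga &
  forall (c g b : R) (e E v p : R -> R),
    dissipative Delta alow aup a sigma pmin pmax c g b e E v p ->
    0 <= c -> 0 <= g -> 2 * c * T <= alow ->
    forall s : R, 0 <= s -> s + T <= b -> E (s + T) <= E s / 2 + Ga * g].
Proof.
pose K1 := 2 * aup / alow; pose K := K1 + 1.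
have K10 : 0 < K1 by rewrite divr_gt0// mulr_gt0.
have K0 : 0 < K by rewrite addr_gt0.
(* A window with [p <= ep * Z] has [E <= Z / (2 * K1)], which the growth factor [K1] turns into
   [Z / 2] at the end of the horizon. *)
pose ep := pmin / (2 * K1).
have ep0 : 0 < ep by rewrite divr_gt0// mulr_gt0.
pose r := Num.min 1 (ep / (2 * (sigma * K))).
have sK0 : 0 < 2 * (sigma * K) by rewrite !mulr_gt0.
have r01 : 0 < r <= 1 by rewrite lt_min ltr01 divr_gt0// ge_min lexx.
have rK : 2 * (sigma * K) * r <= ep.
  by rewrite mulrC -ler_pdivlMr// ge_min lexx orbT.
pose N := (Num.truncn (4 * aup * pmax / (a * ep * r))).+1.
have NH : 4 * aup * pmax < N%:R * (a * ep * r).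
  rewrite -ltr_pdivrMr; last by case/andP: r01 => ? _; do 2 apply: mulr_gt0 => //.
  exact: (real_truncnS_gt (num_real _)).
pose T := N%:R * (Delta + 1).
have T0 : 0 < T by rewrite mulr_gt0// ?ltr0n// ltr_wpDl.
pose K2 := 2 * T / alow; have K20 : 0 < K2 by rewrite divr_gt0// mulr_gt0.
(* [K2 + 1] pays for the terms in [g] of [X + g <= K * Z], and [T / aup] for the input term [T * g]
   of the budget of [v]. *)
pose G := K2 + 1 + T / aup.
have hK1 : alow * K1 = 2 * aup by rewrite /K1; field; rewrite gt_eqF.
have hK2 : alow * K2 = 2 * T by rewrite /K2; field; rewrite gt_eqF.
have hG : aup * G = aup * (K2 + 1) + T by rewrite /G; field; rewrite gt_eqF.
have hG2 : K2 + 1 <= G by rewrite lerDl divr_ge0// ltW.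
have hep : pmin = ep * (2 * K1) by rewrite /ep; field; rewrite gt_eqF.
have window_le := @dissipative_window_le T.
rewrite -/K1 -/K2 in window_le.
have hT : N%:R * (Delta + 1) = T by [].
have hK : K = K1 + 1 by [].
clearbody G K2 T N r ep K K1.
exists T, (G / 2 + K2); split => //; first by move: hG2 K20; lra.
move=> c g b e E v p H c0 g0 cT s s0 sTb.
have sb : 0 <= s <= b by rewrite s0 (le_trans _ sTb)// lerDl ltW.
have Es0 : 0 <= E s.
  by apply: le_trans (diss_ge0 H s) (diss_win H sb _); rewrite lerBlDr lerDl Delta0 lexx.
pose Z := E s + G * g; pose X := K1 * E s + K2 * g.
have Gg : (K2 + 1) * g <= G * g by rewrite ler_wpM2r.
have K2g : 0 <= K2 * g by rewrite mulr_ge0// ltW.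
have K1E : 0 <= K1 * E s by rewrite mulr_ge0// ltW.
have Z0 : 0 <= Z by move: Gg K2g; rewrite /Z; lra.
have XgZ : X + g <= K * Z.
  have H2 : 0 <= K1 * (G * g) by apply: mulr_ge0; [exact: ltW|move: Gg K2g; lra].
  by move: H2 Gg; rewrite /X /Z hK; lra.
have eX (t : R) : s - Delta <= t <= s + T -> e t <= X.
  by apply: (window_le _ _ _ _ _ _ _ H (ltW T0) c0 g0 cT s _ s0 _ sTb); rewrite ?lexx// lerDl ltW.
have EX (t : R) : s <= t <= s + T -> E t <= X.
  move=> /andP[st tT]; apply: (diss_win_le H); first by rewrite (le_trans s0 st) (le_trans tT sTb).
  move=> q /andP[q1 q2]; apply: eX; rewrite (le_trans q2 tT) andbT.
  by apply: le_trans q1; rewrite lerD2r.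
have budget : aup * E s + (c * X + g) * T <= 2 * aup * Z.
  have X0 : 0 <= X by exact: addr_ge0.
  have H1 := ler_wpM2r X0 cT.
  have H2 : alow * X = 2 * aup * E s + 2 * T * g by rewrite /X mulrDr !mulrA hK1 hK2.
  have H3 : aup * (G * g) = aup * ((K2 + 1) * g) + T * g by rewrite mulrA hG; ring.
  have H4 : 0 <= aup * ((K2 + 1) * g).
    by apply: mulr_ge0; [exact: ltW|move: K2g g0; lra].
  by move: H1 H2 H3 H4; rewrite /Z; lra.
(* It suffices to be small at one time [s'] of the horizon: the growth estimate restarted at [s']
   covers the final window. *)
have halve s' : s <= s' -> s' <= s + T -> E s' <= Z / (2 * K1) ->
    E (s + T) <= E s / 2 + (G / 2 + K2) * g.
  move=> ss' s'T Es'.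
  have s'0 := le_trans s0 ss'.
  have sTs' : s + T <= s' + T by rewrite lerD2r.
  have W := window_le _ _ _ _ _ _ _ H (ltW T0) c0 g0 cT _ _ s'0 s'T sTb sTs'.
  have -> : E s / 2 + (G / 2 + K2) * g = Z / 2 + K2 * g by rewrite /Z; ring.
  apply: (diss_win_le H); first by rewrite sTb andbT (le_trans s0)// lerDl ltW.
  move=> t /andP[t1 t2]; apply: le_trans (W t _) _.
    by rewrite t2 andbT (le_trans _ t1)// lerD2r.
  rewrite lerD2r -ler_pdivlMl//; apply: (le_trans Es').
  by rewrite invfM mulrA mulrC.
(* If [Z] vanishes there is neither history nor input, and [s' = s] works; the counting argument
   needs [0 < Z] for its strict inequality. *)
have [Zp|Zn] := ltP 0 Z; last first.
  apply: (halve s) => //; first by rewrite lerDl ltW.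
  apply: (@le_trans _ _ 0); last by rewrite divr_ge0// mulr_ge0// ltW.
  apply: (le_trans (EX s _)); first by rewrite lexx lerDl ltW.
  by have := ler_wpM2l (ltW K0) Zn; move: XgZ g0; lra.
have sNb : s + N%:R * (Delta + 1) <= b by rewrite hT.
rewrite -hT in EX budget.
have [j [jN Hj]] := dissipative_small_window H c0 s0 sNb (ltW K0) r01 rK NH EX Zp XgZ budget.
have q0 : 0 <= j%:R * (Delta + 1) by rewrite mulr_ge0// addr_ge0.
have jT : s + j%:R * (Delta + 1) + Delta <= s + T.
  rewrite -addrA lerD2l -hT (@le_trans _ _ (j.+1%:R * (Delta + 1)))//.
    by rewrite -natr1 mulrDl lerD2l mul1r lerDl.
  by rewrite ler_wpM2r ?addr_ge0// ler_nat.
apply: (halve _ _ jT); first by rewrite -addrA lerDl addr_ge0.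
apply: (diss_win_le H); first by rewrite (le_trans jT sTb) !addr_ge0.
move=> t /andP[t1 t2]; rewrite addrK in t1.
have tb : 0 <= t <= b.
  by rewrite (le_trans t2 (le_trans jT sTb)) (le_trans _ t1)// addr_ge0.
have pt : p t <= ep * Z by apply: Hj; rewrite t1 t2.
have /andP[pe _] := diss_p H tb.
rewrite ler_pdivlMr ?mulr_gt0// -(ler_pM2l ep0) mulrCA -hep mulrC.
exact: le_trans pe pt.
Qed.

Lemma dissipative_exp_bound : exists T K eta C : R,
  [/\ 0 < T, 0 < K, 0 < eta, 0 <= C & forall (c g b : R) (e E v p : R -> R),
    dissipative Delta alow aup a sigma pmin pmax c g b e E v p ->
    0 <= c -> 0 <= g -> 2 * c * T <= alow ->
    forall t : R, 0 <= t <= b -> e t <= K * E 0 * expR (- (2 * eta) * t) + C * g].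
Proof.
have [T [Ga [T0 Ga0 halving]]] := dissipative_halving.
pose K1 := 2 * aup / alow; have K10 : 0 < K1 by rewrite divr_gt0// mulr_gt0.
pose K2 := 2 * T / alow; have K20 : 0 < K2 by rewrite divr_gt0// mulr_gt0.
(* Then [expR (- (2 * eta) * t)] is [2] to the power [- t / T]; the factor 2 in [2 * K1] compensates
   for rounding [t / T] down. The rate is [2 * eta] because [e] is a squared norm. *)
pose eta := ln 2 / (2 * T).
have eta0 : 0 < eta by rewrite divr_gt0 ?mulr_gt0// ln_gt0// ltr1n.
exists T, (2 * K1), eta, (K1 * (2 * Ga) + K2); split => //.
- by rewrite mulr_gt0.
- by apply: addr_ge0; [apply: mulr_ge0; [exact: ltW|exact: mulr_ge0]|exact: ltW].
move=> c g b e E v p H c0 g0 cT t /andP[t0 tb].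
have E00 : 0 <= E 0.
  have b0 : (0 : R) <= 0 <= b by rewrite lexx (le_trans t0).
  by apply: le_trans (diss_ge0 H 0) (diss_win H b0 _); rewrite sub0r lexx oppr_le0 Delta0.
(* [2 * Ga * g] is the fixed point of the recursion [y / 2 + Ga * g]. *)
have iter k : k%:R * T <= b -> E (k%:R * T) <= E 0 / 2 ^+ k + 2 * Ga * g.
  elim: k => [_|k IH kb].
    by rewrite mul0r expr0 divr1 lerDl !mulr_ge0.
  have kS : k.+1%:R * T = k%:R * T + T by rewrite -natr1; ring.
  rewrite kS in kb *.
  have {IH} IH := IH (le_trans _ kb); rewrite lerDl in IH; have {}IH := IH (ltW T0).
  have kT0 : 0 <= k%:R * T by rewrite mulr_ge0// ltW.
  have := halving _ _ _ _ _ _ _ H c0 g0 cT _ kT0 kb; rewrite exprS invfM.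
  by move: IH; lra.
pose k := Num.truncn (t / T).
have /andP[k1 k2] : k%:R * T <= t < k.+1%:R * T.
  rewrite -ler_pdivlMr// -ltr_pdivrMr//.
  by apply: truncn_itv; rewrite divr_ge0// ltW.
have kT0 : 0 <= k%:R * T by rewrite mulr_ge0// ltW.
have kb : k%:R * T <= b by exact: le_trans tb.
have kt : t <= k%:R * T + T by move: k2; rewrite -natr1 mulrDl mul1r => /ltW.
have := dissipative_window_le H (ltW T0) c0 g0 cT kT0 k1 tb kt (r := t).
rewrite lexx (le_trans _ k1) ?gerBl// => /(_ isT) /le_trans; apply.
rewrite -/K1 -/K2.
have /(ler_wpM2l (ltW K10)) H1 := iter k kb.
have H2 : (2 ^+ k)^-1 <= 2 * expR (- (2 * eta) * t).
  have -> : 2 * expR (- (2 * eta) * t) = expR (ln 2 - (2 * eta) * t).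
    by rewrite expRD lnK ?posrE// mulNr.
  have -> : (2 ^+ k)^-1 = expR (- (k%:R * ln 2)) :> R.
    by rewrite expRN expRM_natl lnK ?posrE.
  rewrite ler_expR lerBrDl /eta.
  have -> : 2 * (ln 2 / (2 * T)) * t = ln 2 * (t / T) by field; rewrite gt_eqF.
  have : t / T <= k%:R + 1 by rewrite ler_pdivrMr// mulrDl mul1r.
  have : 0 < ln 2 :> R by rewrite ln_gt0// ltr1n.
  by move=> ln20 /(ler_wpM2l (ltW ln20)); lra.
have /(ler_wpM2l (mulr_ge0 (ltW K10) E00)) := H2.
by move: H1; lra.
Qed.

End Contraction.

(** * Lyapunov inequalities along trajectories *)

Section Trajectories.
Context {R : realType}.
Notation mu := (@lebesgue_measure R).

(** One-sided, like the comparison lemmas; this survives clamping a solution at the end of an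
    interval. *)
Definition right_deriv n (x : R -> 'cV[R]_n) (t : R) (w : 'cV[R]_n) : Prop :=
  forall e : R, 0 < e -> exists2 d : R, 0 < d &
    forall h, 0 < h < d -> enorm (x (t + h) - x t - h *: w) <= e * h.

(** The working notion of solution: continuity on the whole line makes every segment a state, while
    the equation is only asked on the interval. *)
Record trajectory n m (f : (R -> 'cV[R]_n) -> 'cV[R]_m -> 'cV[R]_n) (b : R)
    (u : R -> 'cV[R]_m) (x : R -> 'cV[R]_n) : Prop := Trajectory {
  traj_continuous : continuous x ;
  traj_ac : absolutely_continuous 0 b x ;
  traj_eq : exists2 N : set R, mu.-negligible N &
    forall t, 0 <= t < b -> ~ N t -> right_deriv x t (f (segment x t) (u t)) }.

Definition ae_bounded m (u : R -> 'cV[R]_m) (b U : R) : Prop :=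
  exists2 N : set R, mu.-negligible N &
    forall t, 0 <= t <= b -> ~ N t -> enorm (u t) <= U.

Lemma right_deriv_le n (x : R -> 'cV[R]_n) t w e : right_deriv x t w -> 0 < e ->
  exists2 d : R, 0 < d &
    forall h, 0 < h < d -> enorm (x (t + h) - x t) <= (enorm w + e) * h.
Proof.
move=> H /H[d d0 Hd]; exists d => // h hd; have /andP[h0 _] := hd.
rewrite -[X in enorm X](subrK (h *: w)) (le_trans (enormD _ _))//.
by rewrite enormZ gtr0_norm//; have := Hd h hd; lra.
Qed.

Section WithDelta.
Variables (Delta : R) (n m : nat).
Hypothesis Delta0 : 0 <= Delta.
Implicit Types (f : (R -> 'cV[R]_n) -> 'cV[R]_m -> 'cV[R]_n)
  (V : (R -> 'cV[R]_n) -> R) (x phi psi : R -> 'cV[R]_n) (u : R -> 'cV[R]_m).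

Lemma lipschitz_bounded_fW f : lipschitz_bounded_f Delta f ->
  forall r : R, exists2 L : R, 0 < L & forall phi psi v v',
    cstate Delta n phi -> cstate Delta n psi ->
    supnorm Delta phi <= r -> supnorm Delta psi <= r ->
    enorm v <= r -> enorm v' <= r ->
    enorm (f phi v - f psi v') <= L * (supnorm Delta (phi - psi) + enorm (v - v')).
Proof.
move=> Lf r.
have [||L HL] := Lf [set p | [/\ cstate Delta n p.1, supnorm Delta p.1 <= r & enorm p.2 <= r]].
- by move=> p [].
- by exists (r + r) => p [_ ? ?]; exact: lerD.
exists (`|L| + 1) => [|phi psi v v' cphi cpsi p1 p2 v1 v2]; first by rewrite ltr_wpDl.
apply: (le_trans (HL (phi, v) (psi, v') _ _)) => //=.
have S0 : 0 <= supnorm Delta (phi - psi) by apply: supnorm_ge0 => //; exact: cstateB.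
by rewrite ler_wpM2r ?addr_ge0 ?enorm_ge0// (le_trans (ler_norm L))// lerDl.
Qed.

Lemma lipschitz_bounded_VW V : lipschitz_bounded_V Delta V ->
  forall r : R, exists2 L : R, 0 < L & forall phi psi,
    cstate Delta n phi -> cstate Delta n psi ->
    supnorm Delta phi <= r -> supnorm Delta psi <= r ->
    `|V phi - V psi| <= L * supnorm Delta (phi - psi).
Proof.
move=> LV r.
have [||L HL] := LV [set p | cstate Delta n p /\ supnorm Delta p <= r].
- by move=> p [].
- by exists r => p [].
exists (`|L| + 1) => [|phi psi cphi cpsi p1 p2]; first by rewrite ltr_wpDl.
apply: (le_trans (HL phi psi _ _)) => //=.
have S0 : 0 <= supnorm Delta (phi - psi) by apply: supnorm_ge0 => //; exact: cstateB.
by rewrite ler_wpM2r// (le_trans (ler_norm L))// lerDl.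
Qed.

Lemma f_bounded f : lipschitz_bounded_f Delta f ->
  forall r : R, exists2 M : R, 0 <= M & forall phi v,
    cstate Delta n phi -> supnorm Delta phi <= r -> enorm v <= r ->
    enorm (f phi v) <= M.
Proof.
move=> Lf r; have [L L0 HL] := lipschitz_bounded_fW Lf `|r|.
exists (L * (`|r| + `|r|) + enorm (f (fun=> 0) 0)) => [|phi v cphi pr vr].
  by rewrite addr_ge0 ?enorm_ge0// mulr_ge0 ?(ltW L0)// addr_ge0.
rewrite -[X in enorm X](subrK (f (fun=> 0) 0)) (le_trans (enormD _ _))// lerD2r.
have c0 : cstate Delta n (fun=> 0) by apply: continuous_cstate => //; exact: cst_continuous.
have rr := ler_norm r.
apply: (le_trans (HL phi (fun=> 0) v 0 cphi c0 _ _ _ _)).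
- exact: le_trans pr rr.
- by rewrite supnorm0.
- exact: le_trans vr rr.
- by rewrite enorm0.
rewrite ler_pM2l// lerD//; last by rewrite subr0 (le_trans vr rr).
apply: (le_trans _ rr); apply: (le_trans _ pr).
by apply: supnorm_le => // t tD; rewrite !fctE subr0; exact: supnorm_ub.
Qed.

Lemma segment_bound x (b M t : R) :
  (forall t, - Delta <= t <= b -> enorm (x t) <= M) -> 0 <= t <= b ->
  supnorm Delta (segment x t) <= M.
Proof.
move=> HM /andP[t0 tb]; apply: supnorm_le => // s /andP[s1 s2].
by apply: HM; apply/andP; split; lra.
Qed.

Lemma segment_uniform x (l b : R) : continuous x ->
  forall e : R, 0 < e -> exists2 d : R, 0 < d &
    forall s t, l <= s <= b -> l <= t <= b -> `|s - t| < d ->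
      supnorm Delta (segment x s - segment x t) <= e.
Proof.
move=> cx e e0; have [d d0 Hd] := heine (l - Delta) b cx e0.
exists d => // s t /andP[s0 sb] /andP[t0 tb] st; apply: supnorm_le => // r /andP[r1 r2].
rewrite !fctE; apply: Hd; [by apply/andP; split; lra|by apply/andP; split; lra|].
by rewrite (_ : s + r - (t + r) = s - t)//; ring.
Qed.

(** [f] is bounded along [x], which upgrades absolute continuity to a Lipschitz bound. It starts at
    time 0, since the history is merely continuous, and it controls [x] at exceptional times. *)
Lemma trajectory_lipschitz f b U u x : lipschitz_bounded_f Delta f ->
  ae_bounded u b U -> trajectory f b u x ->
  exists2 L : R, 0 <= L & forall s t, 0 <= s -> s <= t -> t <= b ->
    enorm (x t - x s) <= L * (t - s).
Proof.
move=> Lf [N0 negN0 HU] [cx acx [N negN HN]].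
have [M M0 HM] := continuous_bounded (- Delta) b cx.
have [L L0 HL] := f_bounded Lf (Num.max M U).
exists L => // s t s0 st tb; rewrite mulrBr.
apply: (@absolutely_continuous_le _ _ x (fun t => L * t) s t (N `|` N0)) => //.
- exact: absolutely_continuousS acx.
- exact: negligibleU.
- by move=> p q _ pq _; rewrite ler_wpM2l.
move=> r /andP[sr rt] /not_orP[Nr N0r] e e0.
have r0b : 0 <= r < b by apply/andP; split; lra.
have [d d0 Hd] := right_deriv_le (HN r r0b Nr) e0.
exists d => // h hd _; apply: (le_trans (Hd h hd)).
have -> : L * (r + h) - L * r + e * h = (L + e) * h by ring.
rewrite ler_wpM2r; [by []|by case/andP: hd => /ltW|].
have r0b' : 0 <= r <= b by case/andP: r0b => -> /ltW.
rewrite lerD2r; apply: (HL _ _ (cstate_segment Delta0 cx r)).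
  by rewrite le_max (segment_bound HM).
by rewrite le_max (HU r) ?orbT.
Qed.

Lemma continuous_comp_lipschitz1 x (g : R -> R) : continuous x ->
  (forall s t, `|g s - g t| <= `|s - t|) -> continuous (x \o g).
Proof.
move=> /enorm_continuousP cx Hg; apply/enorm_continuousP => t e e0.
have [d d0 Hd] := cx (g t) e e0; exists d => // s st; apply: Hd.
exact: le_lt_trans (Hg _ _) st.
Qed.

Lemma cstate_shift_driver phi h w : continuous phi ->
  cstate Delta n (shift_driver phi h w).
Proof.
move=> cphi.
apply: continuous_cstate => //.
(* Written with a minimum and a maximum, the driver state is a sum of two globally continuous
   functions. *)
have -> : shift_driver phi h w =
    (phi \o (fun s => Num.min (s + h) 0)) + (fun s => Num.max (h + s) 0 *: w).
  apply/funext => s; rewrite /shift_driver !fctE /=.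
  case: ltP => sh.
    by rewrite min_l ?max_r ?scale0r ?addr0//; lra.
  by rewrite min_r ?max_l//; lra.
move=> s; apply: cvgD.
  apply: (continuous_comp_lipschitz1 cphi) => p q.
  have := ler_norm (p - q); have := lerNnormlW (lexx `|p - q|).
  by case: (leP (p + h)) => ?; case: (leP (q + h)) => ?; rewrite ler_norml; lra.
move: s; apply/enorm_continuousP => t e e0.
exists (e / (enorm w + 1)); first by rewrite divr_gt0// ltr_wpDl// enorm_ge0.
move=> s; rewrite ltr_pdivlMr ?ltr_wpDl ?enorm_ge0// => st.
rewrite -scalerBl enormZ.
have H : `|Num.max (h + s) 0 - Num.max (h + t) 0| <= `|s - t|.
  have := ler_norm (s - t); have := lerNnormlW (lexx `|s - t|).
  by case: (leP (h + s)) => ?; case: (leP (h + t)) => ?; rewrite ler_norml; lra.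
apply: (le_trans (ler_wpM2r (enorm_ge0 w) H)).
by have := normr_ge0 (s - t); lra.
Qed.

Lemma shift_driver_bound phi h w M : 0 <= h <= 1 ->
  (forall t, - Delta <= t <= 0 -> enorm (phi t) <= M) ->
  supnorm Delta (shift_driver phi h w) <= M + enorm w.
Proof.
move=> /andP[h0 h1] HM; have w0 := enorm_ge0 w.
apply: supnorm_le => // s /andP[s1 s2]; rewrite /shift_driver; case: ltP => sh.
  by rewrite (le_trans (HM _ _)) ?lerDl//; apply/andP; split; lra.
rewrite (le_trans (enormD _ _))// lerD ?HM ?window0// enormZ ger0_norm; last by lra.
by rewrite ler_piMl//; lra.
Qed.

(** Before [- h] both states are the same piece of [x]; after it they differ by the first-order
    remainder of [x] in direction [w]. *)
Lemma segment_shift_driver x t h w D :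
  0 <= D -> (forall k, 0 < k <= h -> enorm (x (t + k) - x t - k *: w) <= D) ->
  supnorm Delta (segment x (t + h) - shift_driver (segment x t) h w) <= D.
Proof.
move=> D0 HD; apply: supnorm_le => // s /andP[s1 s2].
rewrite !fctE /shift_driver /segment; case: ltP => sh.
  by rewrite (_ : t + h + s = t + (s + h)) ?subrr ?enorm0//; ring.
rewrite addr0 opprD addrA (_ : t + h + s = t + (h + s)); last by ring.
have [hs0|hs] := leP (h + s) 0.
  have -> : h + s = 0 by lra.
  by rewrite addr0 scale0r !subr0 subrr enorm0.
by apply: HD; rewrite hs/=; lra.
Qed.

Lemma driver_derivative_le V phi w (q : R) :
  (driver_derivative V phi w <= q%:E)%E -> forall e : R, 0 < e ->
  exists2 d : R, 0 < d & forall h, 0 < h < d ->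
    V (shift_driver phi h w) - V phi <= (q + e) * h.
Proof.
move=> Hq e e0.
have : (driver_derivative V phi w < (q + e)%:E)%E.
  by apply: le_lt_trans Hq _; rewrite lte_fin ltrDl.
move=> /ereal_inf_lt[_ [A A0 <-] HA].
have /nbhs_ballP[d /= d0 Hd] := A0.
exists d => // h /andP[h0 hd].
have Ah : A h by apply: Hd => //; rewrite /ball/= sub0r normrN gtr0_norm.
rewrite -ler_pdivrMr// -lee_fin; apply: le_trans (ltW HA).
by apply: ereal_sup_ubound; exists h.
Qed.

Section Lyapunov.
Variables (f : (R -> 'cV[R]_n) -> 'cV[R]_m -> 'cV[R]_n)
  (V : (R -> 'cV[R]_n) -> R) (gamma : R -> R) (P : 'M[R]_n).
Variables (alow aup a sigma c : R).
Hypotheses (a0 : 0 < a) (c0 : 0 <= c) (sigma0 : 0 < sigma).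
Hypotheses (Lf : lipschitz_bounded_f Delta f) (LV : lipschitz_bounded_V Delta V).
Hypothesis gammaN : class_N gamma.
Hypothesis V_sandwich : forall phi, cstate Delta n phi ->
  alow * enorm (phi 0) ^+ 2 <= V phi <= aup * supnorm Delta phi ^+ 2.
Hypothesis V_driver : forall phi v, cstate Delta n phi ->
  (driver_derivative V phi (f phi v) <=
    (- a * enorm (phi 0) ^+ 2 + c * supnorm Delta phi ^+ 2 + gamma (enorm v))%:E)%E.
Hypothesis P_growth : forall phi v, cstate Delta n phi ->
  ((phi 0)^T *m P *m f phi v) 0 0 >=
    - sigma * (supnorm Delta phi ^+ 2 + gamma (enorm v)).
Hypothesis P_posdef : symmetric_posdef P.

Lemma class_N_le (s t : R) : 0 <= s -> s <= t -> gamma s <= gamma t.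
Proof.
case: gammaN => _ H _ s0 st.
by apply: H => //; rewrite in_itv/= andbT// (le_trans s0).
Qed.

Lemma class_N_ge0 (s : R) : 0 <= s -> 0 <= gamma s.
Proof. by move=> s0; case: (gammaN) => _ _ <-; exact: class_N_le. Qed.

Variables (b U : R) (u : R -> 'cV[R]_m) (x : R -> 'cV[R]_n).
Hypotheses (U0 : 0 <= U) (uU : ae_bounded u b U) (traj : trajectory f b u x).

Let e t : R := enorm (x t) ^+ 2.
Let E t : R := supnorm Delta (segment x t) ^+ 2.

Let cx : continuous x. Proof. by case: traj. Qed.

(** The driver continues the state along a straight line, unlike [x]. The Lipschitz bound on [V]
    turns the first-order remainder of [x] into an error negligible against [h], so off a null set
    the driver inequality bounds the Dini derivative of [V] along [x]. *)
Lemma trajectory_V_le s t k : 0 <= s -> s <= t -> t <= b ->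
  (forall r, s <= r <= t -> - a * e r + c * E r + gamma U <= k) ->
  V (segment x t) - V (segment x s) <= k * (t - s).
Proof.
move=> s0 st tb Hk.
have [Lx Lx0 HLx] := trajectory_lipschitz Lf uU traj.
have [M M0 HM] := continuous_bounded (- Delta) b cx.
case: traj => _ _ [N negN HN]; case: uU => N0 negN0 HU.
have [Mf Mf0 HMf] := f_bounded Lf (Num.max M U).
(* The radius also covers the driver states: for [h <= 1] their straight part adds at most [Mf]. *)
have [L L0 HL] := lipschitz_bounded_VW LV (M + Mf).
have cseg := cstate_segment Delta0 cx.
have MM : M <= M + Mf by rewrite lerDl.
have segM r : 0 <= r <= b -> supnorm Delta (segment x r) <= M.
  exact: (segment_bound HM).
have fM r v : 0 <= r <= b -> enorm v <= U -> enorm (f (segment x r) v) <= Mf.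
  move=> rb vU; apply: (HMf _ _ (cseg r)); first by rewrite le_max segM.
  by rewrite le_max vU orbT.
have step r h w D : 0 <= r -> r + h <= b -> 0 < h <= 1 -> enorm w <= Mf -> 0 <= D ->
    (forall k, 0 < k <= h -> enorm (x (r + k) - x r - k *: w) <= D) ->
    V (segment x (r + h)) - V (shift_driver (segment x r) h w) <= L * D.
  move=> r0 rh /andP[h0 h1] wM D0 HD.
  apply: (le_trans (ler_norm _)).
  have csd : cstate Delta n (shift_driver (segment x r) h w).
    by apply: cstate_shift_driver; exact: continuous_segment.
  apply: (le_trans (HL _ _ (cseg (r + h)) csd _ _)).
  - by rewrite (le_trans (segM _ _))//; apply/andP; split; lra.
  - apply: (le_trans (shift_driver_bound w (M := M) _ _)); first by rewrite (ltW h0).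
      move=> q qD; apply: (le_trans (supnorm_ub Delta0 (cseg r) qD)).
      by apply: segM; apply/andP; split; lra.
    by rewrite lerD2l.
  - by rewrite ler_pM2l//; exact: segment_shift_driver.
pose C := L * (Lx + Mf) + (c * M ^+ 2 + gamma 0 + 1).
apply: (@dini_le _ (fun r => V (segment x r)) s t k C (N `|` N0)) => //.
- exact: negligibleU.
- move=> r /andP[sr rt] q q0.
  have qL : 0 < q / L by rewrite divr_gt0.
  have [d d0 Hd] := segment_uniform 0 b cx qL.
  exists d => // p /andP[sp pr] rdp.
  have r0b : 0 <= r <= b by apply/andP; split; lra.
  have p0b : 0 <= p <= b by apply/andP; split; lra.
  have rp : `|r - p| < d by rewrite gtr0_norm; lra.
  apply: (le_trans (HL _ _ (cseg r) (cseg p) _ _)).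
  + by rewrite (le_trans (segM _ _)).
  + by rewrite (le_trans (segM _ _)).
  + by rewrite mulrC -ler_pdivlMr// Hd.
- move=> r /andP[sr rt] /not_orP[Nr N0r] q q0.
  have r0b : 0 <= r <= b by apply/andP; split; lra.
  have r0b' : 0 <= r < b by apply/andP; split; lra.
  have uU' := HU r r0b N0r.
  pose w := f (segment x r) (u r).
  have q2 : 0 < q / 2 by rewrite divr_gt0.
  have [d1 d10 Hd1] := driver_derivative_le (V_driver (u r) (cseg r)) q2.
  have qL : 0 < q / 2 / L by rewrite divr_gt0.
  have [d2 d20 Hd2] := HN r r0b' Nr _ qL.
  exists (Num.min 1 (Num.min d1 d2)); first by rewrite !lt_min ltr01 d10.
  move=> h; rewrite !lt_min => /andP[h0 /and3P[h1 hd1 hd2]] rht.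
  have := Hd1 h; rewrite h0 hd1 => /(_ isT) H1.
  have H2 : V (segment x (r + h)) - V (shift_driver (segment x r) h w) <= L * (q / 2 / L * h).
    apply: step; [lra|lra|by rewrite h0 ltW|exact: fM|by rewrite mulr_ge0 ?ltW|].
    move=> k' /andP[k0 kh].
    apply: (le_trans (Hd2 k' _)); first by rewrite k0 (le_lt_trans kh).
    by rewrite ler_pM2l.
  have H3 : L * (q / 2 / L * h) = q / 2 * h by field; rewrite gt_eqF.
  have H4 := Hk r; rewrite sr ltW// in H4; have {}H4 := H4 isT.
  have H5 : gamma (enorm (u r)) <= gamma U by apply: class_N_le => //; exact: enorm_ge0.
  have H6 : - a * enorm (segment x r 0) ^+ 2 + c * supnorm Delta (segment x r) ^+ 2
      + gamma (enorm (u r)) + q / 2 <= k + q / 2.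
    by rewrite lerD2r; apply: le_trans H4; rewrite /segment addr0 lerD2l.
  have := ler_wpM2r (ltW h0) H6; rewrite H3 in H2.
  by move: H1 H2; rewrite /w; lra.
(* At an exceptional time the direction [f(x_r, 0)] need not be the derivative
   of [x], but the driver inequality still applies to it, and the error is linear
   in [h] because [x] is Lipschitz. *)
- move=> r /andP[sr rt].
  have r0b : 0 <= r <= b by apply/andP; split; lra.
  pose w := f (segment x r) 0.
  have wM : enorm w <= Mf by apply: fM => //; rewrite enorm0.
  have [d1 d10 Hd1] := driver_derivative_le (V_driver 0 (cseg r)) ltr01.
  exists (Num.min 1 d1); first by rewrite !lt_min ltr01 d10.
  move=> h; rewrite !lt_min => /and3P[h0 h1 hd1] rht.
  have := Hd1 h; rewrite h0 hd1 => /(_ isT) H1.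
  have H2 : V (segment x (r + h)) - V (shift_driver (segment x r) h w) <= L * ((Lx + Mf) * h).
    apply: step; [lra|lra|by rewrite h0 ltW|by []|by rewrite mulr_ge0 ?addr_ge0// ltW|].
    move=> k' /andP[k0 kh].
    apply: (le_trans (enormD _ _)); rewrite enormN enormZ gtr0_norm//.
    have H2 : enorm (x (r + k') - x r) <= Lx * (r + k' - r) by apply: HLx; lra.
    have H3 := ler_wpM2l (ltW k0) wM.
    have H4 : (Lx + Mf) * k' <= (Lx + Mf) * h by rewrite ler_wpM2l// addr_ge0.
    by lra.
  have H3 : - a * enorm (segment x r 0) ^+ 2 + c * supnorm Delta (segment x r) ^+ 2
      + gamma (enorm (0 : 'cV[R]_m)) + 1 <= c * M ^+ 2 + gamma 0 + 1.
    rewrite enorm0 !lerD2r mulNr -[leRHS]add0r lerD//.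
      by rewrite oppr_le0 mulr_ge0 ?sqr_ge0// ltW.
    have H3 := supnorm_ge0 Delta0 (cseg r).
    by apply: ler_wpM2l => //; rewrite ler_pXn2r// segM.
  have := ler_wpM2r (ltW h0) H3.
  by move: H1 H2; rewrite /C /w; lra.
Qed.

(** The comparison is applied to [- x^T P x]: by positivity of [P] the quadratic term of an
    increment has the favourable sign, leaving the linear term [- 2 x^T P d], with [d] the increment
    of [x]. Its factor is why [sigma] is doubled. *)
Lemma trajectory_P_ge s t k : 0 <= s -> s <= t -> t <= b ->
  (forall r, s <= r <= t -> 2 * sigma * (E r + gamma U) <= k) ->
  - (k * (t - s)) <= bform P (x t) (x t) - bform P (x s) (x s).
Proof.
move=> s0 st tb Hk.
have [Lx Lx0 HLx] := trajectory_lipschitz Lf uU traj.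
have [M M0 HM] := continuous_bounded (- Delta) b cx.
case: traj => _ _ [N negN HN]; case: uU => N0 negN0 HU.
have [C C0 HC] := bform_bound P.
have [cP cP0 HcP] := posdef_coercive P_posdef.
have sP : P^T = P by case: P_posdef.
have xM r : 0 <= r <= b -> enorm (x r) <= M.
  move=> /andP[r0 rb]; apply: HM; rewrite rb andbT.
  by apply: le_trans r0; rewrite oppr_le0 Delta0.
pose p r : R := - bform P (x r) (x r).
have CM0 : 0 <= 2 * C * M by rewrite !mulr_ge0// ltW.
have pD r h : 0 <= r <= b -> p (r + h) - p r <= - 2 * bform P (x r) (x (r + h) - x r).
  move=> rb; rewrite /p -{1 2}[x (r + h)](subrK (x r)) addrC.
  move: (x (r + h) - x r) => d; rewrite bformDl !bformDr (bform_sym d (x r) sP).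
  have : 0 <= bform P d d by apply: le_trans (HcP d); rewrite mulr_ge0 ?sqr_ge0// ltW.
  by lra.
have Pbd r v : 0 <= r <= b -> - 2 * bform P (x r) v <= 2 * C * M * enorm v.
  move=> rb; have := HC (x r) v; rewrite ler_norml => /andP[H1 _].
  have xr := xM r rb.
  have := ler_wpM2r (enorm_ge0 v) xr => /(ler_wpM2l (ltW C0)); lra.
suff : p t - p s <= k * (t - s) by rewrite /p; lra.
apply: (@dini_le _ p s t k (2 * C * M * Lx) (N `|` N0)) => //.
- exact: negligibleU.
- move=> r /andP[sr rt] q q0.
  have K0 : 0 < 2 * C * M * Lx + 1 by rewrite ltr_wpDl// mulr_ge0.
  exists (q / (2 * C * M * Lx + 1)); first by rewrite divr_gt0.
  move=> y /andP[sy yr]; rewrite ltrBlDr -ltrBlDl ltr_pdivlMr// => ryq.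
  have xry : enorm (x r - x y) <= Lx * (r - y) by apply: HLx; lra.
  rewrite /p opprK addrC.
  have -> : bform P (x y) (x y) - bform P (x r) (x r) =
      - (bform P (x r) (x r - x y) + bform P (x y) (x r - x y)).
    by rewrite !bformBr (bform_sym (x y) (x r) sP); ring.
  rewrite normrN (le_trans (ler_normD _ _))//.
  have xr : enorm (x r) <= M by apply: xM; apply/andP; split; lra.
  have xy : enorm (x y) <= M by apply: xM; apply/andP; split; lra.
  have H1 := HC (x r) (x r - x y); have H2 := HC (x y) (x r - x y).
  have := ler_wpM2r (enorm_ge0 (x r - x y)) xr => /(ler_wpM2l (ltW C0)) H3.
  have := ler_wpM2r (enorm_ge0 (x r - x y)) xy => /(ler_wpM2l (ltW C0)) H4.
  by have := ler_wpM2l CM0 xry; lra.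
- move=> r /andP[sr rt] /not_orP[Nr N0r] q q0.
  have r0b : 0 <= r <= b by apply/andP; split; lra.
  have r0b' : 0 <= r < b by apply/andP; split; lra.
  have uU' := HU r r0b N0r.
  have qC : 0 < q / (2 * C * M + 1) by rewrite divr_gt0// ltr_wpDl.
  have [d d0 Hd] := HN r r0b' Nr _ qC.
  exists d => // h hd rht; have /andP[h0 _] := hd.
  apply: (le_trans (pD r h r0b)).
  move: Hd; set w := f (segment x r) (u r) => Hd.
  rewrite -[X in bform P _ X](subrK (h *: w)) bformDr bformZr.
  have := P_growth (u r) (cstate_segment Delta0 cx r).
  have -> : segment x r 0 = x r by rewrite /segment addr0.
  rewrite -/w -/(bform P (x r) w) => Hw.
  have H5 : gamma (enorm (u r)) <= gamma U by apply: class_N_le => //; exact: enorm_ge0.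
  have H1 := Pbd r (x (r + h) - x r - h *: w) r0b.
  have H2 := ler_wpM2l CM0 (Hd h hd).
  have H3 : 2 * C * M * (q / (2 * C * M + 1) * h) <= q * h.
    rewrite mulrA ler_wpM2r ?(ltW h0)// mulrA ler_pdivrMr ?ltr_wpDl//.
    by rewrite mulrC ler_pM2l// lerDl.
  have H4 := Hk r; rewrite sr ltW// in H4; have {}H4 := H4 isT.
  have H6 : - 2 * bform P (x r) w <= k.
    have := ler_wpM2l (ltW sigma0) H5; rewrite /E in H4; lra.
  have := ler_wpM2l (ltW h0) H6; lra.
- move=> r /andP[sr rt]; have r0b : 0 <= r <= b by apply/andP; split; lra.
  exists 1 => // h /andP[h0 _] rht; apply: (le_trans (pD r h r0b)).
  apply: (le_trans (Pbd r _ r0b)).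
  have H : enorm (x (r + h) - x r) <= Lx * (r + h - r) by apply: HLx; lra.
  by have := ler_wpM2l CM0 H; lra.
Qed.

Lemma trajectory_dissipative (pmin pmax : R) : 0 <= b ->
  (forall v, pmin * enorm v ^+ 2 <= bform P v v <= pmax * enorm v ^+ 2) ->
  dissipative Delta alow aup a (2 * sigma) pmin pmax c (gamma U) b
    e E (fun t => V (segment x t)) (fun t => bform P (x t) (x t)).
Proof.
move=> b0 HP.
have seg0 t : segment x t 0 = x t by rewrite /segment addr0.
split.
- by move=> t; exact: sqr_ge0.
- move=> t s _ /andP[s1 s2]; rewrite /e /E ler_pXn2r ?nnegrE ?enorm_ge0//.
    have {1}-> : x s = segment x t (s - t) by rewrite /segment addrCA subrr addr0.
    apply: (supnorm_ub Delta0 (cstate_segment Delta0 cx t)).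
    by apply/andP; split; lra.
  exact: (supnorm_ge0 Delta0 (cstate_segment Delta0 cx t)).
- move=> t M _ HM; have M0 : 0 <= M.
    by apply: le_trans (HM t _); [exact: sqr_ge0|rewrite lexx lerBlDr lerDl Delta0].
  rewrite -(sqr_sqrtr M0) /E ler_pXn2r ?nnegrE ?sqrtr_ge0//; last exact: (supnorm_ge0 Delta0 (cstate_segment Delta0 cx t)).
  apply: supnorm_le => // s /andP[s1 s2].
  rewrite -(@ler_pXn2r _ 2) ?nnegrE ?sqrtr_ge0 ?enorm_ge0// (sqr_sqrtr M0).
  by apply: (HM (t + s)); apply/andP; split; lra.
- have [M M0 HM] := continuous_bounded (- Delta) b cx.
  by exists (M ^+ 2) => t /HM; rewrite /e ler_pXn2r ?nnegrE ?enorm_ge0.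
- by move=> t _; have := V_sandwich (cstate_segment Delta0 cx t); rewrite seg0.
- by move=> t _; exact: HP.
- exact: trajectory_V_le.
- exact: trajectory_P_ge.
Qed.

End Lyapunov.
End WithDelta.
End Trajectories.

(** * Uniqueness *)

Section Uniqueness.
Context {R : realType}.
Notation mu := (@lebesgue_measure R).

Lemma geometric_le0 (r C : R) : (forall k : nat, r <= C / 2 ^+ k) -> r <= 0.
Proof.
move=> H; rewrite leNgt; apply/negP => r0.
pose k := Num.truncn (C / r).
have := H k; rewrite ler_pdivlMr ?exprn_gt0// leNgt => /negP; apply.
have : C / r < k.+1%:R by apply: real_truncnS_gt; exact: num_real.
rewrite ltr_pdivrMr// => /lt_le_trans; apply; rewrite mulrC ler_pM2l//.
by rewrite -natrX ler_nat ltn_expl.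
Qed.

(** Integrating [L * D * expR (2 * L * t)] divides by [2 * L], whence the factor [1 / 2]. It takes
    the place of a Gronwall inequality in uniqueness and gives the contraction in existence. *)
Lemma weighted_halving n (z : R -> 'cV[R]_n) (b D L : R) (N : set R) :
  0 <= D -> 0 < L -> absolutely_continuous 0 b z -> z 0 = 0 -> mu.-negligible N ->
  (forall t, 0 <= t < b -> ~ N t -> exists2 w, right_deriv z t w &
     enorm w <= L * (D * expR (2 * L * t))) ->
  forall t, 0 <= t <= b -> enorm (z t) <= D / 2 * expR (2 * L * t).
Proof.
move=> D0 L0 acz z0 negN Hz t /andP[t0 tb].
have L20 : 0 < 2 * L by rewrite mulr_gt0.
have D20 : 0 <= D / 2 by rewrite divr_ge0.
suff : enorm (z t - z 0) <= D / 2 * expR (2 * L * t) - D / 2 * expR (2 * L * 0).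
  rewrite z0 subr0 => /le_trans; apply.
  by rewrite gerBl mulr_ge0// expR_ge0.
apply: (@absolutely_continuous_le _ _ z (fun t => D / 2 * expR (2 * L * t)) 0 t N) => //.
- exact: absolutely_continuousS acz.
- by move=> p q p0 pq _; rewrite ler_wpM2l// ler_expR ler_pM2l.
move=> r /andP[r0 rt] Nr e e0.
have [|w Hw wL] := Hz r _ Nr; first by rewrite r0 (lt_le_trans rt).
have [d d0 Hd] := right_deriv_le Hw e0.
exists d => // h hd _; apply: (le_trans (Hd h hd)); have /andP[/ltW h0 _] := hd.
rewrite mulrDl lerD2r mulrDr expRD.
have H1 := ler_wpM2r h0 wL.
have H2 : 1 + 2 * L * h <= expR (2 * L * h) by exact: expR_ge1Dx.
have H3 : 0 <= D / 2 * expR (2 * L * r) by rewrite mulr_ge0// expR_ge0.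
by have := ler_wpM2l H3 H2; lra.
Qed.

Lemma right_derivB n (x y : R -> 'cV[R]_n) t v w :
  right_deriv x t v -> right_deriv y t w -> right_deriv (x - y) t (v - w).
Proof.
move=> Hx Hy e e0; have e2 : 0 < e / 2 by rewrite divr_gt0.
have [d1 d10 Hd1] := Hx _ e2; have [d2 d20 Hd2] := Hy _ e2.
exists (Num.min d1 d2) => [|h]; first by rewrite lt_min d10.
rewrite lt_min => /and3P[h0 h1 h2].
have -> : (x - y) (t + h) - (x - y) t - h *: (v - w) =
    (x (t + h) - x t - h *: v) - (y (t + h) - y t - h *: w).
  by rewrite !fctE; apply/matrixP => i j; rewrite !mxE; ring.
rewrite (le_trans (enormD _ _))// enormN.
by have := Hd1 h; have := Hd2 h; rewrite h0 h1 h2 => /(_ isT) ? /(_ isT) ?; lra.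
Qed.

Lemma absolutely_continuousB n (x y : R -> 'cV[R]_n) (a b : R) :
  absolutely_continuous a b x -> absolutely_continuous a b y ->
  absolutely_continuous a b (x - y).
Proof.
move=> Hx Hy e e0; have e2 : 0 < e / 2 by rewrite divr_gt0.
have [d1 d10 Hd1] := Hx _ e2; have [d2 d20 Hd2] := Hy _ e2.
exists (Num.min d1 d2) => [|N s t st disj]; first by rewrite lt_min d10.
rewrite lt_min => /andP[sum1 sum2].
have H1 := Hd1 N s t st disj sum1; have H2 := Hd2 N s t st disj sum2.
apply: le_lt_trans (_ : _ <= \sum_i enorm (x (t i) - x (s i)) + \sum_i enorm (y (t i) - y (s i))) _.
  rewrite -big_split/= ler_sum// => i _; rewrite !fctE.
  rewrite (_ : _ - _ - _ = (x (t i) - x (s i)) - (y (t i) - y (s i))).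
    by rewrite (le_trans (enormD _ _))// enormN.
  by apply/matrixP => p q; rewrite !mxE; ring.
by lra.
Qed.

Lemma is_derive_right_deriv n (x : R -> 'cV[R]_n) (t : R) w :
  is_derive t (1 : R) x w -> right_deriv x t w.
Proof.
move=> [dx <-] e e0.
have n0 : 0 < n%:R + 1 :> R by rewrite ltr_wpDl.
have en : 0 < e / (n%:R + 1) by rewrite divr_gt0.
have /cvgrPdist_le/(_ _ en)/nbhs_ballP[d /= d0 Hd] := dx.
exists d => // h /andP[h0 hd].
have := Hd h; rewrite /ball/= sub0r normrN gtr0_norm// => /(_ hd).
rewrite gt_eqF// => /(_ isT); rewrite -/('D_1 x t).
have -> : h%:A + t = t + h by rewrite addrC /GRing.scale/= mulr1.
set v := 'D_1 x t; move=> H.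
have -> : x (t + h) - x t - h *: v = - (h *: (v - h^-1 *: (x (t + h) - x t))).
  by rewrite scalerBr scalerA mulfV ?gt_eqF// scale1r opprB.
rewrite enormN enormZ gtr0_norm// mulrC ler_pM2r//.
apply: (le_trans (enorm_le_mx_norm _)).
have := ler_wpM2l (ler0n R n) H => /le_trans; apply.
by rewrite mulrCA ler_piMr// ?(ltW e0)// ler_pdivrMr// mul1r lerDl.
Qed.

Variables (Delta : R) (n m : nat) (f : (R -> 'cV[R]_n) -> 'cV[R]_m -> 'cV[R]_n).
Hypothesis Delta0 : 0 <= Delta.
Hypothesis Lf : lipschitz_bounded_f Delta f.

(** The weight is increasing in time, so a pointwise bound passes to the whole past window. *)
Lemma segment_weighted (x y : R -> 'cV[R]_n) (b D L : R) : 0 < L -> 0 <= D ->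
  (forall t, - Delta <= t <= 0 -> x t = y t) ->
  (forall t, 0 <= t <= b -> enorm (x t - y t) <= D * expR (2 * L * t)) ->
  forall t, 0 <= t <= b ->
    supnorm Delta (segment x t - segment y t) <= D * expR (2 * L * t).
Proof.
move=> L0 D0 xy HD t /andP[t0 tb]; apply: supnorm_le => // s /andP[s1 s2].
rewrite !fctE /segment.
have [ts|ts] := leP 0 (t + s).
  apply: (le_trans (HD _ _)); first by apply/andP; split; lra.
  by rewrite ler_wpM2l// ler_expR ler_pM2l ?mulr_gt0//; lra.
rewrite xy ?subrr ?enorm0 ?mulr_ge0 ?expR_ge0//.
by apply/andP; split; [have := Delta0; lra|lra].
Qed.

(** Both trajectories are bounded, which starts an induction halving the weighted bound on their
    difference at each step. *)
Lemma trajectory_unique (b U : R) u (x y : R -> 'cV[R]_n) :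
  ae_bounded u b U -> trajectory f b u x -> trajectory f b u y ->
  (forall t, - Delta <= t <= 0 -> x t = y t) ->
  forall t, - Delta <= t <= b -> x t = y t.
Proof.
move=> [N0 negN0 HU] [cx acx [N1 negN1 HN1]] [cy acy [N2 negN2 HN2]] xy.
have [M1 M10 HM1] := continuous_bounded (- Delta) b cx.
have [M2 M20 HM2] := continuous_bounded (- Delta) b cy.
have [L L0 HL] := lipschitz_bounded_fW Delta0 Lf (Num.max (Num.max M1 M2) U).
suff H t : 0 <= t <= b -> x t = y t.
  move=> t /andP[t1 t2]; have [t0|t0] := leP t 0; first by apply: xy; rewrite t1.
  by apply: H; rewrite ltW.
suff H (k : nat) s : 0 <= s <= b -> enorm (x s - y s) <= (M1 + M2) / 2 ^+ k * expR (2 * L * s).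
  move=> tb; apply/eqP; rewrite -subr_eq0; apply/eqP/enorm_eq0.
  apply: (@geometric_le0 _ ((M1 + M2) * expR (2 * L * t))) => k.
  by apply: (le_trans (H k t tb)); rewrite mulrAC.
elim: k s => [s sb|k IH].
  rewrite expr0 divr1; apply: (le_trans (enormD _ _)); rewrite enormN.
  have sD : - Delta <= s <= b by case/andP: sb => ? ->; rewrite andbT; have := Delta0; lra.
  have := lerD (HM1 s sD) (HM2 s sD) => /le_trans; apply.
  rewrite ler_peMr ?addr_ge0//; apply: le_trans (expR_ge1Dx _).
  rewrite lerDl; apply: mulr_ge0; last by case/andP: sb.
  by apply: mulr_ge0 => //; exact: ltW.
have D0 : 0 <= (M1 + M2) / 2 ^+ k by rewrite divr_ge0 ?addr_ge0// exprn_ge0.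
have -> : (M1 + M2) / 2 ^+ k.+1 = (M1 + M2) / 2 ^+ k / 2 by rewrite exprSr invfM mulrA.
apply: (@weighted_halving _ (x - y) b _ L (N0 `|` (N1 `|` N2))) => //.
- exact: absolutely_continuousB.
- by rewrite !fctE (xy 0 (window0 Delta0)) subrr.
- by apply: negligibleU => //; exact: negligibleU.
move=> r /andP[r0 rb] /not_orP[N0r /not_orP[N1r N2r]].
have rb' : 0 <= r < b by rewrite r0.
have rb'' : 0 <= r <= b by rewrite r0 ltW.
exists (f (segment x r) (u r) - f (segment y r) (u r)).
  by apply: right_derivB; [exact: HN1|exact: HN2].
apply: (le_trans (HL _ _ _ _ (cstate_segment Delta0 cx r) (cstate_segment Delta0 cy r) _ _ _ _)).
- by rewrite !le_max (segment_bound Delta0 HM1).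
- by rewrite !le_max (segment_bound Delta0 HM2) ?orbT.
- by rewrite !le_max HU ?orbT.
- by rewrite !le_max HU ?orbT.
rewrite subrr enorm0 addr0 ler_pM2l//.
exact: (segment_weighted L0 D0 xy IH rb'').
Qed.

(** Clamping flattens the solution after [b], but affects neither right derivatives at [t < b] nor
    the relevant part of the segments; [eq_f] makes the latter precise. *)
Lemma solution_trajectory x0 u (T : \bar R) x (b : R) :
  solution Delta f x0 u T x -> 0 <= b -> (b%:E < T)%E ->
  trajectory f b u (x \o clamp (- Delta) b).
Proof.
move=> [_ cont init lac [N [mN muN HN]]] b0 bT.
have Db : - Delta <= b by rewrite (le_trans _ b0)// oppr_le0.
set x' := x \o _.
have x'E t : - Delta <= t <= b -> x' t = x t by move=> tb; rewrite /x' /= clampE.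
have cx' : continuous x'.
  apply: continuous_comp_clamp => //; apply: continuous_subspaceW cont => t.
  rewrite /= in_itv/= => /andP[-> tb]; split=> //.
  by rewrite (le_lt_trans _ bT)// lee_fin.
have x'E0 t : 0 <= t <= b -> x' t = x t.
  by move=> /andP[t0 tb]; apply: x'E; rewrite tb andbT (le_trans _ t0)// oppr_le0.
split => //.
- move=> e e0; have [d d0 Hd] := lac b b0 bT e e0.
  exists d => // M s t st disj sumd.
  rewrite (eq_bigr (fun i => enorm (x (t i) - x (s i)))); first exact: Hd.
  move=> i _; have [/andP[s0 sti] tb] := st i.
  by rewrite !x'E0// ?s0 ?(le_trans s0) ?(le_trans sti).
- exists N; first by exists N; split => //; exact: subset_refl.
  move=> t /andP[t0 tb] Nt.
  have tT : (t%:E < T)%E by rewrite (lt_trans _ bT)// lte_fin.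
  have Ht : is_derive t (1 : R) x (f (segment x t) (u t)).
    by apply: contrapT => nt; apply: Nt; apply: HN => /(_ t0 tT).
  have segE s : - Delta <= s <= 0 -> segment x t s = segment x' t s.
    move=> /andP[s1 s2]; rewrite /segment x'E//; apply/andP; split; lra.
  have <- : f (segment x t) (u t) = f (segment x' t) (u t).
    have cxt : cstate Delta n (segment x t).
      by apply/(cstateP Delta0); exists (segment x' t); [exact: continuous_segment|exact: segE].
    exact: (eq_f Delta0 _ Lf cxt (cstate_segment Delta0 cx' t) segE).
  move=> e e0; have [d d0 Hd] := is_derive_right_deriv Ht e0.
  exists (Num.min d (b - t)) => [|h]; first by rewrite lt_min d0 subr_gt0.
  rewrite lt_min => /and3P[h0 hd hb].
  rewrite !x'E0; first by apply: Hd; rewrite h0.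
    by apply/andP; split; lra.
  by apply/andP; split; lra.
Qed.

End Uniqueness.

(** * Existence *)

Section Primitive.
Context {R : realType}.
Notation mu := (@lebesgue_measure R).

(** A superlevel set is the countable union of the preimages of those rational boxes on which [g]
    exceeds [c] within the ball of radius [U]; joint continuity puts every point of the set in such
    a box. *)
Lemma measurable_joint_continuous m (g : R -> 'cV[R]_m -> R) (w : R -> 'cV[R]_m) (U : R) :
  (forall j, measurable_fun [set: R] (fun t => w t j 0)) ->
  (forall t, enorm (w t) <= U) ->
  (forall t v, enorm v <= U -> forall e : R, 0 < e -> exists2 d : R, 0 < d &
     forall t' v', `|t' - t| < d -> enorm (v' - v) < d -> enorm v' <= U ->
       `|g t' v' - g t v| < e) ->
  measurable_fun [set: R] (fun t => g t (w t)).
Proof.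
move=> mw wU cg mD; apply: (measurability _ (RGenOInfty.measurableE R)) => //.
move=> /= _ [_ [c ->] <-]; rewrite setTI.
pose ep (k : nat) : R := k.+1%:R^-1.
have ep0 k : 0 < ep k by rewrite invr_gt0.
pose box (i : rat * 'cV[rat]_m * nat) : set R :=
  [set t | `|t - ratr i.1.1| < ep i.2] `&`
  \bigcap_(j in [set: 'I_m]) [set t | `|w t j 0 - ratr (i.1.2 j 0)| < ep i.2].
pose good (i : rat * 'cV[rat]_m * nat) := forall (t : R) (v : 'cV[R]_m), `|t - ratr i.1.1| < ep i.2 ->
  (forall j, `|v j 0 - ratr (i.1.2 j 0)| < ep i.2) -> enorm v <= U -> c < g t v.
rewrite [X in measurable X](_ : _ = \bigcup_i (if pselect (good i) then box i else set0)).
  apply: countable_bigcupT_measurable => [|i]; first exact: countableP.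
  have mI (h : R -> R) (q e : R) : measurable_fun [set: R] h ->
      measurable [set t | `|h t - q| < e].
    move=> mh; rewrite (_ : [set t | _] = h @^-1` `]q - e, q + e[%classic).
      by rewrite -[X in measurable X]setTI; apply: mh => //; exact: measurable_itv.
    by apply/seteqP; split => t /=; rewrite in_itv/= ltr_distl.
  case: pselect => [gi|ngi] /=; last exact: measurable0.
  apply: measurableI.
    exact: (mI id).
  by apply: fin_bigcap_measurable => // j _; apply: mI.
apply/seteqP; split => [t /=|t [i _]].
  rewrite in_itv/= andbT => cgt.
  have gc0 : 0 < g t (w t) - c by rewrite subr_gt0.
  have [d d0 Hd] := cg t (w t) (wU t) _ gc0.
  have m0 : 0 < m%:R + 1 :> R by rewrite ltr_wpDl.
  (* Two points of one box differ by at most [2 * ep k] in each coordinate, hence by at most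
     [m * (2 * ep k) < d] in Euclidean norm. *)
  pose k := Num.truncn (2 * (m%:R + 1) / d).
  have kd : 2 * (m%:R + 1) * ep k < d.
    rewrite /ep ltr_pdivrMr ?ltr0n// [ltRHS]mulrC -ltr_pdivrMr//.
    by apply: real_truncnS_gt; exact: num_real.
  have rat_near (y : R) : {q : rat | `|y - ratr q| < ep k}.
    have : y - ep k < y + ep k by rewrite ltrD2l gt0_cp.
    move=> /rat_in_itvoo/cid[q]; rewrite in_itv/= => /andP[q1 q2]; exists q.
    by rewrite distrC ltr_distl q1.
  pose i := (sval (rat_near t), \col_j sval (rat_near (w t j 0)), k).
  exists i => //.
  have it : `|t - ratr i.1.1| < ep i.2 by rewrite /i/=; case: (rat_near t).
  have iw j : `|w t j 0 - ratr (i.1.2 j 0)| < ep i.2.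
    by rewrite /i/= mxE; case: (rat_near (w t j 0)).
  case: pselect => [gi|ngi]; first by split => //= j _; exact: iw.
  apply: ngi => t' v' t't v'w v'U.
  have epd : 2 * ep k <= 2 * (m%:R + 1) * ep k.
    by rewrite ler_pM2r// mulrDr mulr1 lerDr mulr_ge0.
  have : `|g t' v' - g t (w t)| < g t (w t) - c.
    apply: Hd => //.
      apply: le_lt_trans kd; apply: le_trans epd.
      rewrite -[t' - t](subrKA (ratr i.1.1)) (le_trans (ler_normD _ _))//.
      by rewrite mulr_natl mulr2n lerD ?ltW// distrC.
    apply: le_lt_trans kd; apply: (@le_trans _ _ (m%:R * (2 * ep k))).
      apply: enorm_le_coord => j; rewrite !mxE.
      rewrite -[v' j 0 - w t j 0](subrKA (ratr (i.1.2 j 0))) (le_trans (ler_normD _ _))//.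
      by rewrite mulr_natl mulr2n lerD ?(ltW (v'w _))// distrC ltW.
    by rewrite mulrCA mulrA ler_pM2r// ler_pM2l// lerDl.
  by rewrite ltr_norml => /andP[]; lra.
case: pselect => [gi|ngi] /=; last by [].
move=> [t1 t2]; rewrite in_itv/= andbT.
by apply: gi => // j; exact: t2.
Qed.

Lemma bounded_integrable_itv (g : R -> R) (M : R) (a b : R) :
  measurable_fun [set: R] g -> (forall t, `|g t| <= M) ->
  mu.-integrable `[a, b] (EFin \o g).
Proof.
move=> mg gM; apply: measurable_bounded_integrable => //.
- by rewrite /= lebesgue_measure_itv/=; case: ifP => // _; rewrite -EFinB ltry.
- exact: measurable_funTS.
- by exists M; split; [exact: num_real|move=> y My t _ /=; rewrite (le_trans (gM t))// ltW].
Qed.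

Definition primitive (g : R -> R) (t : R) : R := \int[mu]_(s in `[0, t]) g s.

Lemma primitive0 g : primitive g 0 = 0.
Proof. by rewrite /primitive set_itv1 Rintegral_set1. Qed.

Lemma primitive_lipschitz (g : R -> R) (M : R) :
  measurable_fun [set: R] g -> (forall t, `|g t| <= M) ->
  forall s t, 0 <= s -> s <= t -> `|primitive g t - primitive g s| <= M * (t - s).
Proof.
move=> mg gM s t s0 st.
have I a b := bounded_integrable_itv a b mg gM.
have mu_st : mu `]s, t] = (t - s)%:E.
  rewrite lebesgue_measure_itv/= lte_fin; move: st; rewrite le_eqVlt => /predU1P[->|->].
    by rewrite ltxx subrr.
  by rewrite -EFinB.
have Ist : mu.-integrable `]s, t] (EFin \o g).
  by apply: integrableS (I s t) => //; exact: subset_itv_oc_cc.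
rewrite /primitive Rintegral_itvB//.
apply: (le_trans (le_normr_Rintegral _ _)) => //.
have -> : M * (t - s) = \int[mu]_(x in `]s, t]) M by rewrite Rintegral_cst//= mu_st.
apply: le_Rintegral => //.
- by have := integrable_abse Ist.
- apply: (@integrableS _ _ _ mu `[s, t]) => //; first exact: subset_itv_oc_cc.
  apply: (@bounded_integrable_itv (cst M) `|M|) => //.
Qed.

(** Lebesgue differentiation. The primitive vanishes at negative times, so a two-sided derivative is
    claimed only for [0 < t]. *)
Lemma primitive_is_derive (g : R -> R) (M : R) :
  measurable_fun [set: R] g -> (forall t, `|g t| <= M) ->
  {ae mu, forall t : R, 0 < t -> is_derive t (1 : R) (primitive g) (g t)}.
Proof.
move=> mg gM.
have I a b := bounded_integrable_itv a b mg gM.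
have lg : locally_integrable [set: R] g.
  split => //; first exact: openT.
  move=> K _ cK.
  have /integrableP[] // : mu.-integrable K (EFin \o g).
  have [B [_ HB]] := compact_bounded cK.
  apply: (@integrableS _ _ _ mu `[- (`|B| + 1), `|B| + 1]) => //.
  - exact: compact_measurable.
  - move=> x Kx; rewrite /= in_itv/= -ler_norml; apply: HB => //.
    by rewrite (le_lt_trans (ler_norm _))// ltrDl.
have := @FTC1 R g (BLeft 0) (I 0) lg.
apply: filterS; first exact: (ae_filter_ringOfSetsType mu).
move=> t Ht t0.
have [|dg <-] := Ht; first by rewrite /= lte_fin.
by rewrite derive1E; apply: DeriveDef.
Qed.

End Primitive.

(** * Picard iteration for a bounded Lipschitz right-hand side *)

Section Picard.
Context {R : realType}.
Notation mu := (@lebesgue_measure R).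

Variables (Delta : R) (n m : nat) (F : (R -> 'cV[R]_n) -> 'cV[R]_m -> 'cV[R]_n).
Variables (w : R -> 'cV[R]_m) (U L M : R) (x0 : R -> 'cV[R]_n).
Hypotheses (Delta0 : 0 <= Delta) (L0 : 0 < L) (M0 : 0 <= M).
Hypothesis F_lip : forall phi psi v v', cstate Delta n phi -> cstate Delta n psi ->
  enorm v <= U -> enorm v' <= U ->
  enorm (F phi v - F psi v') <= L * (supnorm Delta (phi - psi) + enorm (v - v')).
Hypothesis F_bounded : forall phi v, cstate Delta n phi -> enorm v <= U ->
  enorm (F phi v) <= M.
Hypothesis w_measurable : forall j, measurable_fun [set: R] (fun t => w t j 0).
Hypothesis w_bounded : forall t, enorm (w t) <= U.
Hypothesis x0_cstate : cstate Delta n x0.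

Let X0 := x0 \o clamp (- Delta) 0.

Let continuous_X0 : continuous X0.
Proof. by apply: continuous_comp_clamp => //; rewrite oppr_le0. Qed.

Let X0_ge0 t : 0 <= t -> X0 t = x0 0.
Proof. by move=> t0; rewrite /X0/= /clamp min_l// max_r// oppr_le0. Qed.

Let rhs (y : R -> 'cV[R]_n) (t : R) : 'cV[R]_n := F (segment y t) (w t).

(* [X0] is constant on the half-line [t >= 0] and the integral term vanishes on
   the past, so the sum is the initial state there. *)
Definition picard (y : R -> 'cV[R]_n) (t : R) : 'cV[R]_n :=
  X0 t + \col_i primitive (fun s => rhs y s i 0) (Num.max t 0).

(** Uniform continuity of [y] makes its segments depend continuously on time in the sup norm, so
    [F (segment y t) v] is jointly continuous in [t] and [v]. *)
Lemma rhs_measurable (y : R -> 'cV[R]_n) i : continuous y ->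
  measurable_fun [set: R] (fun s => rhs y s i 0).
Proof.
move=> cy; apply: (@measurable_joint_continuous _ _ (fun t v => F (segment y t) v i 0) w U) => //.
move=> t v vU e e0.
have eL : 0 < e / 2 / L / 2 by rewrite !divr_gt0.
have [d d0 Hd] := segment_uniform Delta0 (t - 1) (t + 1) cy eL.
exists (Num.min (Num.min d 1) (e / 2 / L / 2)); first by rewrite !lt_min d0 ltr01.
move=> t' v'; rewrite !lt_min => /andP[/andP[td t1] _] /andP[_ vv] v'U.
have -> : F (segment y t') v' i 0 - F (segment y t) v i 0 =
    (F (segment y t') v' - F (segment y t) v) i 0 by rewrite !mxE.
apply: (le_lt_trans (enorm_coord _ _)).
have cs := cstate_segment Delta0 cy.
apply: (le_lt_trans (F_lip (cs t') (cs t) v'U vU)).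
have H1 : supnorm Delta (segment y t' - segment y t) <= e / 2 / L / 2.
  move: t1; rewrite ltr_norml => /andP[? ?].
  by apply: Hd => //; apply/andP; split; lra.
apply: (@le_lt_trans _ _ (L * (e / 2 / L / 2 + e / 2 / L / 2))).
  by rewrite ler_pM2l// lerD// ltW.
have -> : L * (e / 2 / L / 2 + e / 2 / L / 2) = e / 2 by field; rewrite gt_eqF.
by lra.
Qed.

Lemma rhs_bounded (y : R -> 'cV[R]_n) i t : continuous y -> `|rhs y t i 0| <= M.
Proof.
move=> cy; apply: (le_trans (enorm_coord _ _)).
exact: (F_bounded (cstate_segment Delta0 cy t)).
Qed.

Lemma picard_past (y : R -> 'cV[R]_n) t : t <= 0 -> picard y t = X0 t.
Proof.
move=> t0; rewrite /picard max_r// -[RHS]addr0; congr (_ + _).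
by apply/matrixP => i j; rewrite !mxE primitive0.
Qed.

Lemma picard_lipschitz (y : R -> 'cV[R]_n) s t : continuous y -> 0 <= s -> s <= t ->
  enorm (picard y t - picard y s) <= n%:R * M * (t - s).
Proof.
move=> cy s0 st; have t0 : 0 <= t by exact: le_trans st.
rewrite /picard !X0_ge0// !max_l// -mulrA; apply: enorm_le_coord => i.
rewrite !mxE opprD addrACA subrr add0r.
by apply: primitive_lipschitz => // [|r]; [exact: rhs_measurable|exact: rhs_bounded].
Qed.

Lemma continuous_picard (y : R -> 'cV[R]_n) : continuous y -> continuous (picard y).
Proof.
move=> cy; move: (continuous_X0) => cX0 t.
apply: cvgD; first exact: cX0.
move: t; apply/enorm_continuousP => t e e0.
have K0 : 0 < n%:R * M + 1 by rewrite ltr_wpDl// mulr_ge0.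
exists (e / (n%:R * M + 1)); first by rewrite divr_gt0.
move=> s; rewrite ltr_pdivlMr// => st.
have H p q : p <= q -> enorm ((\col_i primitive (fun s => rhs y s i 0) (Num.max q 0)) -
    (\col_i primitive (fun s => rhs y s i 0) (Num.max p 0))) <= n%:R * (M * (q - p)).
  move=> pq; apply: enorm_le_coord => i; rewrite !mxE.
  apply: (le_trans (primitive_lipschitz (rhs_measurable i cy) (fun t => rhs_bounded i t cy) _ _)).
  - by rewrite le_max lexx orbT.
  - by rewrite ge_max !le_max pq lexx orbT.
  - rewrite ler_wpM2l//.
    by case: (leP p) => ?; case: (leP q) => ?; lra.
have {}H : enorm ((\col_i primitive (fun s => rhs y s i 0) (Num.max s 0)) -
    (\col_i primitive (fun s => rhs y s i 0) (Num.max t 0))) <= n%:R * (M * `|s - t|).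
  case: (leP s t) => h.
    by rewrite enorm_distC distrC ger0_norm ?subr_ge0//; exact: H.
  by rewrite gtr0_norm ?subr_gt0//; apply: H; exact: ltW.
apply: (le_trans H); have := normr_ge0 (s - t); lra.
Qed.

Lemma picard_is_derive (y : R -> 'cV[R]_n) : continuous y ->
  {ae mu, forall t : R, 0 < t -> is_derive t (1 : R) (picard y) (rhs y t)}.
Proof.
move=> cy.
have : {ae mu, forall t : R, forall i : 'I_n, 0 < t ->
    is_derive t (1 : R) (primitive (fun s => rhs y s i 0)) (rhs y t i 0)}.
  apply: (@filter_forall _ _ _ (almost_everywhere mu) (ae_filter_ringOfSetsType mu)) => i.
  exact: (primitive_is_derive (rhs_measurable i cy) (fun t => rhs_bounded i t cy)).
apply: filterS; first exact: (ae_filter_ringOfSetsType mu).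
move=> t Ht t0.
have Hij (i : 'I_n) (j : 'I_1) : is_derive t (1 : R) (fun s => picard y s i j) (rhs y t i j).
  rewrite ord1; apply: (@near_eq_is_derive _ _ _
    (fun s => primitive (fun s => rhs y s i 0) s + x0 0 i 0)).
    have /nbhs_ballP : \forall s \near t, 0 < s by exact: lt_nbhsr.
    move=> [d /= d0 Hd]; apply/nbhs_ballP; exists d => // s /Hd s0.
    by rewrite /picard X0_ge0 ?(ltW s0)// max_l ?(ltW s0)// !mxE addrC.
  have := Ht i t0 => H; rewrite -[rhs y t i 0]addr0.
  exact: is_deriveD.
have dP : derivable (picard y) t 1.
  by apply/derivable_mxP => i j; case: (Hij i j).
apply: DeriveDef => //; rewrite derive_mx//; apply/matrixP => i j.
by rewrite mxE; case: (Hij i j).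
Qed.

Lemma picard_ac (y : R -> 'cV[R]_n) b : continuous y -> absolutely_continuous 0 b (picard y).
Proof.
move=> cy; apply: (@lipschitz_absolutely_continuous _ _ _ _ _ (n%:R * M)) => s t s0 st _.
exact: picard_lipschitz.
Qed.

Lemma picard_contraction (y z : R -> 'cV[R]_n) (b D : R) : continuous y -> continuous z -> 0 <= D ->
  (forall t, - Delta <= t <= 0 -> y t = z t) ->
  (forall t, 0 <= t <= b -> enorm (y t - z t) <= D * expR (2 * L * t)) ->
  forall t, 0 <= t <= b -> enorm (picard y t - picard z t) <= D / 2 * expR (2 * L * t).
Proof.
move=> cy cz D0 yz HD.
have [N1 [mN1 muN1 HN1]] := picard_is_derive cy.
have [N2 [mN2 muN2 HN2]] := picard_is_derive cz.
(* Time 0 is exceptional because the derivatives are known at positive times only. *)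
have negN : mu.-negligible ([set 0] `|` (N1 `|` N2)).
  apply: negligibleU.
    by exists [set 0]; split => //; exact: lebesgue_measure_set1.
  by apply: negligibleU; [exists N1; split => //; exact: subset_refl
                         |exists N2; split => //; exact: subset_refl].
apply: (@weighted_halving _ _ (picard y - picard z) b D L _ D0 L0 _ _ negN).
- by apply: absolutely_continuousB; exact: picard_ac.
- by rewrite !fctE !picard_past// subrr.
move=> t /andP[t0 tb] /not_orP[/= tn0 /not_orP[N1t N2t]].
have tp : 0 < t by rewrite lt_neqAle t0 andbT eq_sym; apply/eqP.
exists (rhs y t - rhs z t).
  apply: right_derivB; apply: is_derive_right_deriv.
    by apply: contrapT => nt; apply: N1t; apply: HN1 => /(_ tp).
  by apply: contrapT => nt; apply: N2t; apply: HN2 => /(_ tp).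
have cs := cstate_segment Delta0.
apply: (le_trans (F_lip (cs _ _ cy t) (cs _ _ cz t) (w_bounded t) (w_bounded t))).
rewrite subrr enorm0 addr0 ler_pM2l//.
by apply: (segment_weighted Delta0 L0 D0 yz HD); rewrite t0 ltW.
Qed.

(** The tail sums [r k] make the intervals of centre [u k] and radius [r k] nested; the limit is the
    supremum of their left ends. *)
Lemma geometric_cauchy (u : nat -> R) (C : R) :
  (forall k, `|u k.+1 - u k| <= C / 2 ^+ k) ->
  exists l, forall k, `|u k - l| <= 2 * C / 2 ^+ k.
Proof.
move=> H.
have C0 : 0 <= C by have := H 0%N; rewrite expr0 divr1; apply: le_trans.
pose r k := 2 * C / 2 ^+ k.
have rS k : r k.+1 = C / 2 ^+ k by rewrite /r exprS; field; rewrite expf_neq0.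
have rk k : r k = 2 * (C / 2 ^+ k) by rewrite /r; ring.
have up j k : (j <= k)%N -> u k + r k <= u j + r j.
  elim: k => [|k IH]; first by rewrite leqn0 => /eqP ->.
  rewrite leq_eqVlt => /predU1P[->//|]; rewrite ltnS => /IH; apply: le_trans.
  by have := H k; rewrite ler_norml rS rk => /andP[]; lra.
have dn j k : (j <= k)%N -> u j - r j <= u k - r k.
  elim: k => [|k IH]; first by rewrite leqn0 => /eqP ->.
  rewrite leq_eqVlt => /predU1P[->//|]; rewrite ltnS => /IH /le_trans; apply.
  by have := H k; rewrite ler_norml rS rk => /andP[]; lra.
have r0 k : 0 <= r k by rewrite divr_ge0 ?mulr_ge0// exprn_ge0.
have cross j k : u j - r j <= u k + r k.
  have [jk|/ltnW kj] := leqP j k.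
    by apply: (le_trans (dn _ _ jk)); have := r0 k; lra.
  by apply: le_trans (up _ _ kj); have := r0 j; lra.
pose S := [set u k - r k | k in [set: nat]].
exists (sup S) => k.
have supS : has_sup S.
  split; first by exists (u 0%N - r 0%N), 0%N.
  by exists (u 0%N + r 0%N) => _ [j _ <-].
have H1 : u k - r k <= sup S by apply: ub_le_sup; [case: supS|exists k].
have H2 : sup S <= u k + r k.
  by apply: ge_sup; [case: supS|move=> _ [j _ <-]].
by rewrite -/(r k) ler_norml; apply/andP; split; lra.
Qed.

(** The iterates converge uniformly at a geometric rate; the limit, taken at clamped times, is
    globally continuous but a fixed point only on the interval. *)
Lemma picard_fixpoint (b : R) : 0 <= b -> exists2 y : R -> 'cV[R]_n, continuous y &
  forall t, - Delta <= t <= b -> picard y t = y t.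
Proof.
move=> b0.
pose y k := iter k picard X0.
have cy k : continuous (y k).
  by elim: k => [|k IH]; [exact: continuous_X0|exact: continuous_picard].
have y_past k t : t <= 0 -> y k t = X0 t.
  by case: k => [//|k] t0; exact: picard_past.
pose D := n%:R * M * b.
have D0 : 0 <= D by rewrite !mulr_ge0.
have step k t : 0 <= t <= b -> enorm (y k.+1 t - y k t) <= D / 2 ^+ k * expR (2 * L * t).
  elim: k t => [t /andP[t0 tb]|k IH t tb].
    have -> : y 0%N t = picard X0 0 by rewrite picard_past//= !X0_ge0.
    apply: (le_trans (picard_lipschitz continuous_X0 (lexx 0) t0)).
    rewrite subr0 expr0 divr1 (@le_trans _ _ D)//.
      by rewrite ler_wpM2l// mulr_ge0.
    rewrite ler_peMr//; apply: le_trans (expR_ge1Dx _).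
    by rewrite lerDl !mulr_ge0// ltW.
  have -> : D / 2 ^+ k.+1 = D / 2 ^+ k / 2 by rewrite exprSr invfM mulrA.
  apply: (@picard_contraction (y k.+1) (y k) b) => //.
    by rewrite divr_ge0// exprn_ge0.
  by move=> r /andP[_ r0]; rewrite !y_past.
(* The largest value of the weight on the interval turns the weighted bound into a uniform one. *)
pose C := D * expR (2 * L * b).
have C0 : 0 <= C by rewrite mulr_ge0// expR_ge0.
have Db : - Delta <= b by rewrite (le_trans _ b0)// oppr_le0.
have step' k t i : - Delta <= t <= b -> `|y k.+1 t i 0 - y k t i 0| <= C / 2 ^+ k.
  move=> /andP[t1 t2].
  have -> : y k.+1 t i 0 - y k t i 0 = (y k.+1 t - y k t) i 0 by rewrite !mxE.
  apply: (le_trans (enorm_coord _ _)).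
  have [t0|t0] := leP t 0.
    by rewrite !y_past// subrr enorm0 divr_ge0// exprn_ge0.
  apply: (le_trans (step k t _)); first by rewrite (ltW t0).
  rewrite /C mulrAC ler_wpM2r ?invr_ge0 ?exprn_ge0// ler_wpM2l//.
  by rewrite ler_expR ler_pM2l// mulr_gt0.
have lim t : exists l : 'cV[R]_n, forall k,
    enorm (y k (clamp (- Delta) b t) - l) <= n%:R * (2 * C) / 2 ^+ k.
  have tb := clamp_itv t Db.
  have H i := geometric_cauchy (fun k => step' k _ i tb).
  exists (\col_i sval (cid (H i))) => k; rewrite -mulrA.
  by apply: enorm_le_coord => i; rewrite !mxE; case: cid => l /=.
pose z t := sval (cid (lim t)).
have Hz k t : enorm (y k (clamp (- Delta) b t) - z t) <= n%:R * (2 * C) / 2 ^+ k.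
  by rewrite /z; case: cid => l /=.
pose K := n%:R * (2 * C).
have K0 : 0 <= K by rewrite !mulr_ge0.
have geo e : 0 < e -> exists k, K / 2 ^+ k <= e.
  move=> e0; apply: contrapT => H.
  suff : e <= 0 by rewrite leNgt e0.
  apply: (@geometric_le0 _ _ K) => k; rewrite leNgt; apply/negP => h.
  by apply: H; exists k; exact: ltW.
have cz : continuous z.
  apply/enorm_continuousP => t e e0.
  have e3 : 0 < e / 3 by rewrite divr_gt0.
  have [k Hk] := geo _ e3.
  have cyk : continuous (y k \o clamp (- Delta) b).
    by apply: continuous_comp_lipschitz1 => // p q; exact: clamp_dist.
  have [d d0 Hd] := (enorm_continuousP _).1 cyk t _ e3.
  exists d => // s /Hd /= st.
  have -> : z s - z t = (y k (clamp (- Delta) b s) - y k (clamp (- Delta) b t)) +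
      - (y k (clamp (- Delta) b s) - z s) + (y k (clamp (- Delta) b t) - z t).
    by apply/matrixP => i j; rewrite !mxE; ring.
  apply: (le_trans (enormD _ _)); apply: le_trans (lerD (enormD _ _) (lexx _)) _.
  by rewrite enormN; have := Hz k s; have := Hz k t; rewrite -/K; lra.
have zy k t : - Delta <= t <= b -> enorm (y k t - z t) <= K / 2 ^+ k.
  by move=> tb; have := Hz k t; rewrite clampE.
have z_past t : - Delta <= t <= 0 -> z t = X0 t.
  move=> /andP[t1 t2]; apply/esym/eqP; rewrite -subr_eq0; apply/eqP/enorm_eq0.
  apply: (@geometric_le0 _ _ K) => k; rewrite -(y_past k t t2).
  by apply: zy; rewrite t1 (le_trans t2).
exists z => // t /andP[t1 t2]; have [t0|t0] := leP t 0.
  by rewrite picard_past// z_past// t1.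
(* Inserting [picard (y k) t = y k.+1 t], both differences decay like [1 / 2 ^+ k]. *)
apply/eqP; rewrite -subr_eq0; apply/eqP/enorm_eq0.
apply: (@geometric_le0 _ _ (K * expR (2 * L * t) + K)) => k.
have Kk : 0 <= K / 2 ^+ k by rewrite divr_ge0// exprn_ge0.
have tb : 0 <= t <= b by rewrite ltW.
have H1 : enorm (picard z t - picard (y k) t) <= K / 2 ^+ k / 2 * expR (2 * L * t).
  apply: (@picard_contraction z (y k) b) => //.
    by move=> r rD; rewrite z_past// y_past//; case/andP: rD.
  move=> r /andP[r1 r2]; rewrite enorm_distC.
  apply: (le_trans (zy k r _)).
    by rewrite r2 andbT (le_trans _ r1)// oppr_le0.
  rewrite ler_peMr//; apply: le_trans (expR_ge1Dx _).
  by rewrite lerDl mulr_ge0// mulr_ge0// ltW.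
have H2 : enorm (y k.+1 t - z t) <= K / 2 ^+ k.+1 by apply: zy; rewrite t1.
rewrite -[picard z t - z t](subrKA (picard (y k) t)).
apply: (le_trans (enormD _ _)).
have -> : (K * expR (2 * L * t) + K) / 2 ^+ k = K / 2 ^+ k * expR (2 * L * t) + K / 2 ^+ k by ring.
have E0 := expR_ge0 (2 * L * t).
apply: lerD.
  apply: (le_trans H1); rewrite ler_wpM2r//; lra.
apply: (le_trans H2); rewrite exprS invfM mulrCA ler_piMl//; lra.
Qed.

Lemma caratheodory_solution b : 0 <= b -> exists y : R -> 'cV[R]_n,
  [/\ continuous y, forall t, - Delta <= t <= 0 -> y t = x0 t,
      forall s t, 0 <= s -> s <= t -> t <= b -> enorm (y t - y s) <= n%:R * M * (t - s) &
      exists2 N : set R, mu.-negligible N & forall t, 0 <= t < b -> ~ N t ->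
        is_derive t (1 : R) y (F (segment y t) (w t))].
Proof.
move=> b0; have [z cz Hz] := picard_fixpoint b0.
(* The witness is [picard z], whose derivative is known from the integral; it agrees with [z] on
   [[- Delta, b]], so [F] takes the same values on both. *)
exists (picard z); split.
- exact: continuous_picard.
- by move=> t tD; rewrite picard_past ?(andP tD).2// /X0/= clampE.
- by move=> s t s0 st _; exact: picard_lipschitz.
have [N [mN muN HN]] := picard_is_derive cz.
exists ([set 0] `|` N).
  apply: negligibleU; last by exists N; split => //; exact: subset_refl.
  by exists [set 0]; split => //; exact: lebesgue_measure_set1.
move=> t /andP[t0 tb] /not_orP[/= tn0 Nt].
have tp : 0 < t by rewrite lt_neqAle t0 andbT eq_sym; apply/eqP.
have dz : is_derive t (1 : R) (picard z) (rhs z t).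
  by apply: contrapT => nt; apply: Nt; apply: HN => /(_ tp).
suff -> : F (segment (picard z) t) (w t) = rhs z t by [].
apply/eqP; rewrite -subr_eq0; apply/eqP/enorm_eq0.
have cs := cstate_segment Delta0.
apply: (le_trans (F_lip (cs _ _ (continuous_picard cz) t) (cs _ _ cz t) (w_bounded t) (w_bounded t))).
rewrite subrr enorm0 addr0 supnorm0 ?mulr0// => s /andP[s1 s2].
rewrite !fctE /segment Hz ?subrr//.
by apply/andP; split; [have := Delta0; lra|lra].
Qed.

End Picard.

(** * Essential bounds and Borel versions of inputs *)

Section Inputs.
Context {R : realType}.
Notation mu := (@lebesgue_measure R).

Lemma ess_norm_ae_bounded m (u : R -> 'cV[R]_m) (b : R) : input u -> 0 <= b ->
  0 <= fine (ess_norm u b) /\ ae_bounded u b (fine (ess_norm u b)).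
Proof.
move=> [_ ubd] b0.
have n0 : (0 <= ess_norm u b)%E.
  apply: ess_sup_gee; last first.
    by apply: aeW => s; rewrite patchE; case: ifP => // _; rewrite lee_fin enorm_ge0.
  (* Positivity of the total measure makes the essential supremum of a nonnegative function
     nonnegative. *)
  have := @lebesgue_measure_itv R `]-oo, +oo[; rewrite set_itvNyy /= => muT.
  by rewrite [X in (_ < X)%E]muT addye// lt0y.
have finN : ess_norm u b \is a fin_num by rewrite ge0_fin_numE//; exact: ubd.
split; first exact: fine_ge0.
have [N [mN muN HN]] := ess_sup_ge mu ((fun s : R => (enorm (u s))%:E) \_ `[0, b]).
exists N; first by exists N; split => //; exact: subset_refl.
move=> t tb Nt; have /= := contrapT (fun h => Nt (HN t h)).
rewrite -/(ess_norm u b) patchE ifT; last by rewrite inE/= in_itv/= tb.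
by rewrite -[X in (_ <= X)%E](fineK finN) lee_fin.
Qed.

(** The input is measurable for the completed algebra, the primitives for Borel sets. For each
    coordinate and rational level, the superlevel set is Borel up to a null set; these countably
    many null sets fit in one Borel null set [Y], and [u] is replaced by 0 on [Y] and outside
    [[0, b]]. *)
Lemma borel_version m (u : R -> 'cV[R]_m) (b U : R) :
  (forall i, lebesgue_measurable_fun `[0, +oo[ (fun t => u t i 0)) ->
  0 <= U -> ae_bounded u b U ->
  exists w : R -> 'cV[R]_m,
    [/\ forall j, measurable_fun [set: R] (fun t => w t j 0),
        forall t, enorm (w t) <= U &
        exists2 N : set R, mu.-negligible N &
          forall t, 0 <= t <= b -> ~ N t -> w t = u t].
Proof.
move=> mu_ U0 [N0 negN0 HU].
have H (p : 'I_m * rat) : exists AZ : set R * set R,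
    [/\ measurable AZ.1, mu.-negligible AZ.2 &
      forall t, 0 <= t -> ~ AZ.2 t -> (ratr p.2 < u t p.1 0 <-> AZ.1 t)].
  have := mu_ p.1; rewrite /lebesgue_measurable_fun /measurable_fun.
  have m0 : @measurable _ (g_sigma_algebraType (completed_algebra_gen mu)) `[0, +oo[.
    apply: sub_sigma_algebra; exists `[0, +oo[%classic; first exact: measurable_itv.
    by exists set0; [exact: negligible_set0|rewrite setU0].
  move=> /(_ m0 `]ratr p.2, +oo[%classic (measurable_itv _)) mS.
  have : (completed_algebra_gen mu).-sigma.-measurable
    (`[0, +oo[%classic `&` (fun t => u t p.1 0) @^-1` `]ratr p.2, +oo[%classic) by [].
  rewrite g_sigma_completed_algebra_genE => -[A mA [Z negZ AZ]].
  exists (A, Z); split => // t t0 Zt.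
  have -> : (ratr p.2 < u t p.1 0) = (u t p.1 0 \in `]ratr p.2, +oo[) by rewrite in_itv/= andbT.
  split=> [h|At].
    have : (`[0, +oo[ `&` (fun t => u t p.1 0) @^-1` `]ratr p.2, +oo[) t.
      by split => //=; rewrite in_itv/= t0.
    by rewrite -AZ => -[].
  have : (A `|` Z) t by left.
  by rewrite AZ => -[].
pose A p := (sval (cid (H p))).1; pose Z p := (sval (cid (H p))).2.
have HA p : [/\ measurable (A p), mu.-negligible (Z p) &
    forall t, 0 <= t -> ~ Z p t -> (ratr p.2 < u t p.1 0 <-> A p t)].
  by rewrite /A /Z; case: cid.
have negZ : mu.-negligible (\bigcup_k (if unpickle k is Some p then Z p else set0)).
  apply: negligible_bigcup => k; case: unpickle => [p|]; last exact: negligible_set0.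
  by case: (HA p).
have [Y [mY muY HY]] := negligibleU negN0 negZ.
have YZ p t : Z p t -> Y t.
  by move=> Zt; apply: HY; right; exists (pickle p) => //; rewrite pickleK.
have YN t : N0 t -> Y t by move=> Nt; apply: HY; left.
pose E := `[0, b]%classic `\` Y.
have mE : measurable E by apply: measurableD => //; exact: measurable_itv.
pose w t := if t \in E then u t else 0.
exists w; split.
- move=> j mD; apply: (measurability _ (RGenOInfty.measurableE R)) => //.
  move=> /= _ [_ [c ->] <-]; rewrite setTI.
  (* On [E] a value exceeds [c] exactly if it exceeds a rational [q >= c]; off [E] the value is 0,
     which counts when [c < 0]. *)
  rewrite [X in measurable X](_ : _ =
      (\bigcup_(q : rat) (if c <= ratr q then E `&` A (j, q) else set0)) `|`
      (if c < 0 then ~` E else set0)).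
    apply: measurableU.
      apply: bigcupT_measurable_rat => q; case: ifP => // _.
      by apply: measurableI => //; case: (HA (j, q)).
    by case: ifP => // _; exact: measurableC.
  apply/seteqP; split => t /=; rewrite in_itv/= andbT /w.
    case: ifPn => [|tE]; last first.
      by rewrite mxE => c0; right; rewrite c0; move: tE; rewrite notin_setE.
    rewrite inE => tE cu; left.
    have /rat_in_itvoo/cid[q] := cu; rewrite in_itv/= => /andP[cq qu].
    exists q => //; rewrite (ltW cq); split => //.
    have [tb Yt] := tE; have [_ _ HAt] := HA (j, q).
    apply/HAt => //; first by move: tb; rewrite /= in_itv/= => /andP[].
    by move=> /YZ.
  move=> [[q _]|].
    case: ifP => // cq [tE At]; rewrite ifT ?inE//.
    have [tb Yt] := tE; have [_ _ HAt] := HA (j, q).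
    apply: le_lt_trans cq _; apply/HAt => //; last by move=> /YZ.
    by move: tb; rewrite /= in_itv/= => /andP[].
  by case: ifP => // c0 tE; rewrite ifF ?mxE//; apply/negbTE; rewrite notin_setE.
- move=> t; rewrite /w; case: ifPn => [|_]; last by rewrite enorm0.
  rewrite inE => -[tb Yt]; apply: HU; first by move: tb; rewrite /= in_itv.
  by move=> /YN.
- exists Y; first by exists Y; split => //; exact: subset_refl.
  by move=> t tb Yt; rewrite /w ifT// inE; split => //; rewrite /= in_itv.
Qed.

End Inputs.

(** * Truncation of states *)

Section Truncation.
Context {R : realType}.

(** Truncation by coordinates rather than radially: it is 1-Lipschitz by the scalar case, at the
    price of the cruder bound [n * M]. *)
Definition clampv n (M : R) (v : 'cV[R]_n) : 'cV[R]_n := \col_i clamp (- M) M (v i 0).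

Lemma clampv_id n (M : R) (v : 'cV[R]_n) : enorm v <= M -> clampv M v = v.
Proof.
move=> vM; apply/matrixP => i j; rewrite ord1 mxE clampE// -ler_norml.
exact: le_trans (enorm_coord v i) vM.
Qed.

Lemma enorm_clampv n (M : R) (v : 'cV[R]_n) : 0 <= M -> enorm (clampv M v) <= n%:R * M.
Proof.
move=> M0; apply: enorm_le_coord => i; rewrite mxE ler_norml.
by apply: clamp_itv; lra.
Qed.

Lemma clampv_lipschitz n (M : R) (v v' : 'cV[R]_n) :
  enorm (clampv M v - clampv M v') <= enorm (v - v').
Proof.
rewrite ler_wsqrtr// ler_sum// => i _; rewrite !mxE.
rewrite -[leLHS]real_normK ?num_real// -[leRHS]real_normK ?num_real//.
by rewrite ler_pXn2r ?nnegrE// clamp_dist.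
Qed.

Lemma cstate_clampv (Delta M : R) n (phi : R -> 'cV[R]_n) : 0 <= Delta ->
  cstate Delta n phi -> cstate Delta n (clampv M \o phi).
Proof.
move=> Delta0 /(cstateP Delta0)[psi cpsi Hpsi]; apply/(cstateP Delta0).
exists (clampv M \o psi); last by move=> t /Hpsi /= ->.
apply/enorm_continuousP => t e e0.
have [d d0 Hd] := (enorm_continuousP _).1 cpsi t e e0.
exists d => // s /Hd; apply: le_trans; exact: clampv_lipschitz.
Qed.

End Truncation.

(** * Global and maximal solutions from an a priori bound *)

Section Existence.
Context {R : realType}.
Notation mu := (@lebesgue_measure R).
Variables (Delta : R) (n m : nat) (f : (R -> 'cV[R]_n) -> 'cV[R]_m -> 'cV[R]_n).
Hypotheses (Delta0 : 0 <= Delta) (Lf : lipschitz_bounded_f Delta f).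

Lemma is_derive_trajectory (b : R) (u : R -> 'cV[R]_m) (y : R -> 'cV[R]_n) (N : set R) :
  continuous y -> absolutely_continuous 0 b y -> mu.-negligible N ->
  (forall t, 0 <= t < b -> ~ N t -> is_derive t (1 : R) y (f (segment y t) (u t))) ->
  trajectory f b u y.
Proof.
move=> cy acy negN HN; split => //; exists N => // t tb Nt.
by apply: is_derive_right_deriv; exact: HN.
Qed.

Lemma solution_on (x0 : R -> 'cV[R]_n) (u : R -> 'cV[R]_m) (b U B : R) :
  cstate Delta n x0 -> 0 <= b -> 0 <= U ->
  (forall i, lebesgue_measurable_fun `[0, +oo[ (fun t => u t i 0)) ->
  ae_bounded u b U ->
  (forall b' x, 0 <= b' <= b -> trajectory f b' u x ->
     (forall t, - Delta <= t <= 0 -> x t = x0 t) -> enorm (x b') <= B) ->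
  exists y : R -> 'cV[R]_n,
  [/\ continuous y, forall t, - Delta <= t <= 0 -> y t = x0 t,
      absolutely_continuous 0 b y &
      exists2 N : set R, mu.-negligible N & forall t, 0 <= t < b -> ~ N t ->
        is_derive t (1 : R) y (f (segment y t) (u t))].
Proof.
move=> cx0 b0 U0 mu_ uU apriori.
have [w [mw wU [Nw negNw HNw]]] := borel_version mu_ U0 uU.
have [z cz x0z] := (cstateP Delta0 x0).1 cx0.
have [M1 M10 HM1] := continuous_bounded (- Delta) 0 cz.
(* [M1] covers the initial state, which segments still see; the extra 1 is the margin that lets the
   bound on [y] propagate to the right. *)
pose M := Num.max M1 `|B| + 1.
have M0 : 0 <= M by rewrite addr_ge0// le_max M10.
pose r := Num.max (n%:R * M) U.
have [L L0 HL] := lipschitz_bounded_fW Delta0 Lf r.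
have [K K0 HK] := f_bounded Delta0 Lf r.
pose F (phi : R -> 'cV[R]_n) v := f (clampv M \o phi) v.
have Fr (phi : R -> 'cV[R]_n) : supnorm Delta (clampv M \o phi) <= r.
  apply: supnorm_le => // t _; apply: (le_trans (enorm_clampv (phi t) M0)).
  by rewrite /r le_max lexx.
have F_lip (phi psi : R -> 'cV[R]_n) (v v' : 'cV[R]_m) : cstate Delta n phi -> cstate Delta n psi ->
    enorm v <= U -> enorm v' <= U ->
    enorm (F phi v - F psi v') <= L * (supnorm Delta (phi - psi) + enorm (v - v')).
  move=> cphi cpsi vU vU'.
  have c1 : cstate Delta n (clampv M \o phi) by exact: cstate_clampv.
  have c2 : cstate Delta n (clampv M \o psi) by exact: cstate_clampv.
  apply: (le_trans (HL _ _ v v' c1 c2 (Fr _) (Fr _) _ _)).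
  - by rewrite /r le_max vU orbT.
  - by rewrite /r le_max vU' orbT.
  rewrite ler_pM2l// lerD2r; apply: supnorm_le => // t tD; rewrite !fctE /=.
  apply: (le_trans (clampv_lipschitz M _ _)).
  exact: (supnorm_ub Delta0 (cstateB Delta0 cphi cpsi) tD).
have F_bounded (phi : R -> 'cV[R]_n) (v : 'cV[R]_m) : cstate Delta n phi -> enorm v <= U -> enorm (F phi v) <= K.
  move=> cphi vU.
  have c1 : cstate Delta n (clampv M \o phi) by exact: cstate_clampv.
  apply: (HK _ _ c1 (Fr _)).
  by rewrite /r le_max vU orbT.
have [y [cy yx0 y_lip [N negN HN]]] :=
  caratheodory_solution Delta0 L0 K0 F_lip F_bounded mw wU cx0 b0.
have acy : absolutely_continuous 0 b y by apply: lipschitz_absolutely_continuous y_lip.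
have y_deriv b' : 0 <= b' <= b -> (forall t, 0 <= t <= b' -> enorm (y t) <= M) ->
    forall t, 0 <= t < b' -> ~ (N `|` Nw) t -> is_derive t (1 : R) y (f (segment y t) (u t)).
  move=> /andP[b'0 b'b] yM t /andP[t0 tb'] /not_orP[Nt Nwt].
  have tb : 0 <= t < b by rewrite t0 (lt_le_trans tb').
  have tb2 : 0 <= t <= b by rewrite t0 ltW ?(lt_le_trans tb').
  rewrite -(HNw t tb2 Nwt).
  suff -> : f (segment y t) (w t) = F (segment y t) (w t) by exact: HN.
  have cs := cstate_segment Delta0 cy t.
  have csM : cstate Delta n (clampv M \o segment y t) by exact: cstate_clampv.
  apply: (eq_f Delta0 _ Lf cs csM) => s /andP[s1 s2].
  rewrite /= clampv_id// /segment; have [ts|ts] := leP 0 (t + s).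
    by apply: yM; rewrite ts/=; lra.
  have tsD : - Delta <= t + s <= 0 by apply/andP; split; [have := Delta0; lra|lra].
  rewrite yx0// x0z//; apply: (le_trans (HM1 _ tsD)).
  by rewrite ler_wpDr// le_max lexx.
have negNN : mu.-negligible (N `|` Nw) by exact: negligibleU.
suff yM t : 0 <= t <= b -> enorm (y t) <= M.
  exists y; split => //; exists (N `|` Nw) => //.
  by apply: y_deriv => //; rewrite b0 lexx.
have ycont := (enorm_continuousP y).1 cy.
apply: (@real_induction _ (fun t => enorm (y t) <= M)) => {t}.
- rewrite yx0 ?window0// x0z ?window0//; apply: (le_trans (HM1 _ (window0 Delta0))).
  by rewrite ler_wpDr// le_max lexx.
(* While [y] stays below [M] it solves the original equation up to [t], so the a priori estimate
   improves the bound at [t] from [M] to [B <= M - 1]. *)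
- move=> t /andP[t0 tb] ytM.
  have tb' : 0 <= t <= b by rewrite t0 ltW.
  have yB : enorm (y t) <= B.
    apply: (apriori t y tb' _ yx0).
    apply: (is_derive_trajectory cy _ negNN); last exact: y_deriv.
    by apply: absolutely_continuousS acy; exact: ltW.
  have [d d0 Hd] := ycont t 1 ltr01.
  exists d => // s /andP[ts std] _.
  have : enorm (y s - y t) <= 1 by apply: Hd; rewrite gtr0_norm ?subr_gt0// ltrBlDl.
  have BM : B <= M - 1 by rewrite /M addrK le_max ler_norm orbT.
  move=> yst; rewrite -[y s](subrK (y t)); apply: (le_trans (enormD _ _)); lra.
- move=> t /andP[t0 tb] ytM; apply/ler_addgt0Pr => e e0.
  have [d d0 Hd] := ycont t e e0.
  pose s := Num.max 0 (t - d / 2).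
  have s0 : 0 <= s by rewrite le_max lexx.
  have st : s < t by rewrite gt_max t0 ltrBlDr ltrDl divr_gt0.
  have sd : t - d / 2 <= s by rewrite le_max lexx orbT.
  have := ytM s; rewrite s0 st => /(_ isT) ysM.
  have : enorm (y t - y s) <= e.
    rewrite enorm_distC; apply: Hd; rewrite ltr0_norm ?subr_lt0//; lra.
  by move=> yts; rewrite -[y t](subrK (y s)); apply: (le_trans (enormD _ _)); lra.
Qed.

Lemma trajectoryS (b c : R) u x : c <= b -> trajectory f b u x -> trajectory f c u x.
Proof.
move=> cb [cx acx [N negN HN]]; split => //.
  exact: absolutely_continuousS acx.
by exists N => // t /andP[t0 tc]; apply: HN; rewrite t0 (lt_le_trans tc).
Qed.

Lemma ae_boundedS m' (u : R -> 'cV[R]_m') (b c U : R) : c <= b -> ae_bounded u b U -> ae_bounded u c U.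
Proof.
move=> cb [N negN HN]; exists N => // t /andP[t0 tc].
by apply: HN; rewrite t0 (le_trans tc).
Qed.

(** The bound depends on the horizon since [u] is only locally bounded. Solutions on growing
    intervals agree by uniqueness and are glued. *)
Lemma global_solution (x0 : R -> 'cV[R]_n) (u : R -> 'cV[R]_m) (B : R -> R) :
  cstate Delta n x0 -> input u ->
  (forall b b' x, 0 <= b' <= b -> trajectory f b' u x ->
     (forall t, - Delta <= t <= 0 -> x t = x0 t) -> enorm (x b') <= B b) ->
  exists y, solution Delta f x0 u +oo y.
Proof.
move=> cx0 iu apriori.
have ubd b : 0 <= b -> 0 <= fine (ess_norm u b) /\ ae_bounded u b (fine (ess_norm u b)).
  exact: ess_norm_ae_bounded.
have H (k : nat) : exists y : R -> 'cV[R]_n,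
  [/\ continuous y, forall t, - Delta <= t <= 0 -> y t = x0 t,
      absolutely_continuous 0 k.+1%:R y &
      exists2 N : set R, mu.-negligible N & forall t, 0 <= t < k.+1%:R -> ~ N t ->
        is_derive t (1 : R) y (f (segment y t) (u t))].
  have k0 : 0 <= k.+1%:R :> R by [].
  have [U0 uU] := ubd _ k0.
  by apply: (solution_on cx0 k0 U0 iu.1 uU) => b' x; exact: apriori.
pose Y k := sval (cid (H k)).
have HY k : [/\ continuous (Y k), forall t, - Delta <= t <= 0 -> Y k t = x0 t,
      absolutely_continuous 0 k.+1%:R (Y k) &
      exists2 N : set R, mu.-negligible N & forall t, 0 <= t < k.+1%:R -> ~ N t ->
        is_derive t (1 : R) (Y k) (f (segment (Y k) t) (u t))].
  by rewrite /Y; case: cid.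
have trajY k : trajectory f k.+1%:R u (Y k).
  by have [c _ ac [N negN HN]] := HY k; exact: is_derive_trajectory HN.
have YY j k t : (j <= k)%N -> - Delta <= t <= j.+1%:R -> Y j t = Y k t.
  move=> jk; have jk1 : j.+1%:R <= k.+1%:R :> R by rewrite ler_nat.
  have [_ uU] := ubd j.+1%:R (ler0n _ _).
  apply: (trajectory_unique Delta0 Lf uU (trajY j) (trajectoryS jk1 (trajY k))).
  by move=> s sD; have [_ H1 _ _] := HY j; have [_ H2 _ _] := HY k; rewrite H1// H2.
(* [Y k] is valid up to [k + 1], and [t] is below [truncn t + 1]; negative times fall to [Y 0]. *)
pose y t := Y (Num.truncn t) t.
have yY k t : - Delta <= t <= k.+1%:R -> y t = Y k t.
  move=> /andP[t1 t2]; rewrite /y.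
  have tt : t <= (Num.truncn t).+1%:R.
    by apply/ltW/real_truncnS_gt; exact: num_real.
  by have [h|/ltnW h] := leqP (Num.truncn t) k; [|apply/esym]; apply: YY; rewrite ?t1.
have pick_k (t : R) : exists k : nat, t + 1 <= k.+1%:R.
  exists (Num.truncn (t + 1)); apply/ltW/real_truncnS_gt; exact: num_real.
have D0 (t : R) : 0 <= t -> - Delta <= t.
  by move=> t0; rewrite (le_trans _ t0)// oppr_le0.
exists y; split.
- exact: ltry.
- apply/enorm_within_continuousP => t [t1 _] e e0.
  have [k tk] := pick_k t; have [cY _ _ _] := HY k.
  have [d d0 Hd] := (enorm_continuousP _).1 cY t e e0.
  exists (Num.min d 1); first by rewrite lt_min d0 ltr01.
  move=> s [s1 _]; rewrite lt_min => /andP[sd s2].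
  move: s2; rewrite ltr_norml => /andP[s2 s3].
  rewrite !(yY k); first exact: Hd.
    by rewrite t1/=; lra.
  by rewrite s1/=; lra.
- move=> t; rewrite in_itv/= => tD; rewrite (yY 0%N).
    by have [_ H1 _ _] := HY 0%N; exact: H1.
  by case/andP: tD => -> t0; rewrite (le_trans t0).
- move=> b b0 _ e e0; have [k tk] := pick_k b; have [_ _ acY _] := HY k.
  have [d d0 Hd] := acY e e0; exists d => // N s t st disj sumd.
  have st' i : 0 <= s i <= t i /\ t i <= k.+1%:R.
    by have [-> tb] := st i; split => //; lra.
  rewrite (eq_bigr (fun i => enorm (Y k (t i) - Y k (s i)))); first exact: Hd.
  move=> i _; have [/andP[s0 sti] tb] := st' i.
  by rewrite !(yY k)// ?D0 ?(le_trans s0)// (le_trans sti).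
pose NN k := sval (cid2 (let: And4 _ _ _ h := HY k in h)).
have [HN1 HN2] : (forall k, mu.-negligible (NN k)) /\
    (forall k t, 0 <= t < k.+1%:R -> ~ NN k t ->
        is_derive t (1 : R) (Y k) (f (segment (Y k) t) (u t))).
  by split => k; rewrite /NN; case: cid2.
(* At time 0 the gluing gives no two-sided neighbourhood when [Delta = 0]. *)
have : mu.-negligible ([set 0] `|` \bigcup_k NN k).
  apply: negligibleU; last exact: negligible_bigcup.
  by exists [set 0]; split => //; exact: lebesgue_measure_set1.
apply: negligibleS => t nt; apply: contrapT => /not_orP[/= tn0 Nt].
apply: nt => t0 _.
have tp : 0 < t by rewrite lt_neqAle t0 andbT eq_sym; apply/eqP.
have [k tk] := pick_k t.
have tk' : t < k.+1%:R by lra.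
have dY : is_derive t (1 : R) (Y k) (f (segment (Y k) t) (u t)).
  by apply: HN2; [rewrite t0 tk'|move=> h; apply: Nt; exists k].
have [cY _ _ _] := HY k.
have segE s : - Delta <= s <= 0 -> segment y t s = segment (Y k) t s.
  move=> /andP[s1 s2]; rewrite /segment; apply: yY; apply/andP; split; lra.
have cys : cstate Delta n (segment y t).
  by apply/(cstateP Delta0); exists (segment (Y k) t); [exact: continuous_segment|exact: segE].
rewrite (eq_f Delta0 _ Lf cys (cstate_segment Delta0 cY t) segE).
apply: (near_eq_is_derive _ dY).
apply/nbhs_ballP; exists (Num.min t 1); first by rewrite /= lt_min tp ltr01.
move=> s /=; rewrite /ball/= lt_min ltr_norml => /andP[/andP[h1 h2]].
rewrite ltr_norml => /andP[h3 h4].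
by apply/esym/yY; rewrite D0/=; lra.
Qed.

(** By uniqueness the global solution extends every maximal one, whose existence time is therefore
    infinite. *)
Lemma maximal_of_global (x0 : R -> 'cV[R]_n) (u : R -> 'cV[R]_m) y :
  input u -> solution Delta f x0 u +oo y ->
  (exists T x, maximal_solution Delta f x0 u T x) /\
  forall T x, maximal_solution Delta f x0 u T x -> T = +oo%E.
Proof.
move=> iu soly; split.
  by exists +oo%E, y; split => // T' x' _ _; rewrite leey.
move=> T x [solx maxx]; apply/eqP; rewrite eq_le leey/=.
apply: (maxx +oo%E y soly) => t t1 tT.
have [t0|t0] := leP t 0.
  have tD : t \in `[- Delta, 0] by rewrite in_itv/= t1.
  by rewrite (solution_init soly tD) (solution_init solx tD).
have t0' := ltW t0.
have [_ uU] := ess_norm_ae_bounded iu t0'.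
have ty := solution_trajectory Delta0 Lf soly t0' (ltry t).
have tx := solution_trajectory Delta0 Lf solx t0' tT.
have := trajectory_unique Delta0 Lf uU ty tx _ (t := t).
rewrite /= !clampE ?t1 ?lexx//; apply => //.
move=> s sD; rewrite /= clampE; last by case/andP: sD => -> s0; rewrite (le_trans s0).
have sD' : s \in `[- Delta, 0] by rewrite in_itv.
by rewrite (solution_init soly sD') (solution_init solx sD').
Qed.

End Existence.

(** * The exp-ISS estimate *)

Section Final.
Context {R : realType}.

Lemma class_N_sqrt (gamma : R -> R) (C : R) : 0 <= C -> class_N gamma ->
  class_N (fun s => Num.sqrt (C * gamma s)).
Proof.
move=> C0 [cg ng g0]; split.
- apply/subspace_continuousP => s sI.
  have cgs := (subspace_continuousP _ _).1 cg s sI.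
  apply: (@cvg_comp _ _ _ (fun s => C * gamma s) Num.sqrt _ (nbhs (C * gamma s))).
    by apply: cvgM => //; exact: cvg_cst.
  exact: sqrt_continuous.
- move=> s t sI tI st; rewrite ler_wsqrtr// ler_wpM2l//; exact: ng.
- by rewrite g0 mulr0 sqrtr0.
Qed.

Lemma le_sqrt_sum (z y w : R) : 0 <= y -> 0 <= w -> z ^+ 2 <= y ^+ 2 + w ->
  z <= y + Num.sqrt w.
Proof.
move=> y0 w0 H; have s0 := sqrtr_ge0 w; have := sqr_sqrtr w0 => E.
rewrite -E in H; rewrite leNgt; apply/negP => h; nra.
Qed.

Section Estimate.
Variables (Delta : R) (n m : nat) (P : 'M[R]_n) (alow aup a sigma : R).
Hypotheses (Delta0 : 0 <= Delta) (alow0 : 0 < alow) (a0 : 0 < a) (sigma0 : 0 < sigma).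
Hypothesis P_posdef : symmetric_posdef P.

Lemma trajectory_estimate : exists T k eta C : R,
  [/\ 0 < T, 0 < k, 0 < eta, 0 <= C &
  forall (f : (R -> 'cV[R]_n) -> 'cV[R]_m -> 'cV[R]_n)
         (V : (R -> 'cV[R]_n) -> R) (c : R) (gamma : R -> R),
    lipschitz_bounded_f Delta f -> lipschitz_bounded_V Delta V ->
    0 <= c -> class_N gamma ->
    (forall phi, cstate Delta n phi ->
       alow * enorm (phi 0) ^+ 2 <= V phi <= aup * supnorm Delta phi ^+ 2) ->
    (forall phi v, cstate Delta n phi ->
       (driver_derivative V phi (f phi v) <=
        (- a * enorm (phi 0) ^+ 2 + c * supnorm Delta phi ^+ 2
         + gamma (enorm v))%:E)%E) ->
    (forall phi v, cstate Delta n phi ->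
       ((phi 0)^T *m P *m f phi v) 0 0 >=
       - sigma * (supnorm Delta phi ^+ 2 + gamma (enorm v))) ->
    2 * c * T <= alow ->
    forall (u : R -> 'cV[R]_m) (x x0 : R -> 'cV[R]_n) (b U : R), 0 <= b -> 0 <= U ->
      ae_bounded u b U -> trajectory f b u x ->
      (forall t, - Delta <= t <= 0 -> x t = x0 t) ->
      enorm (x b) <= k * supnorm Delta x0 * expR (- eta * b) + Num.sqrt (C * gamma U)].
Proof.
have [pmin pmin0 Hpmin] := posdef_coercive P_posdef.
have [pmax pmax0 Hpmax] := bform_bound P.
(* The contraction argument assumes [alow <= aup]; enlarging [aup] preserves the upper bound on
   [V]. *)
have aupM : alow <= Num.max alow aup by rewrite le_max lexx.
have sigma2 : 0 < 2 * sigma by rewrite mulr_gt0.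
have [T [K [eta [C [T0 K0 eta0 C0 HD]]]]] :=
  dissipative_exp_bound Delta0 alow0 aupM a0 sigma2 pmin0 pmax0.
exists T, (Num.sqrt K), eta, C; split => //; first by rewrite sqrtr_gt0.
move=> f V c gamma Lf LV c0 gN HV HVd HP cT u x x0 b U b0 U0 uU tx xx0.
have gU : 0 <= gamma U by exact: class_N_ge0.
have cx : continuous x by case: tx.
have HV' phi : cstate Delta n phi ->
    alow * enorm (phi 0) ^+ 2 <= V phi <= Num.max alow aup * supnorm Delta phi ^+ 2.
  move=> /HV/andP[-> h]; apply: (le_trans h).
  by rewrite ler_wpM2r ?sqr_ge0// le_max lexx orbT.
have HPb (v : 'cV[R]_n) : pmin * enorm v ^+ 2 <= bform P v v <= pmax * enorm v ^+ 2.
  by rewrite Hpmin expr2 (le_trans (ler_norm _))// Hpmax.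
have diss := trajectory_dissipative Delta0 a0 c0 sigma0 Lf LV gN HV' HVd HP P_posdef U0 uU tx b0 HPb.
have := HD _ _ _ _ _ _ _ diss c0 gU cT b; rewrite b0 lexx => /(_ isT) Hb.
have S0 : 0 <= supnorm Delta (segment x 0) by exact: (supnorm_ge0 Delta0 (cstate_segment Delta0 cx 0)).
have -> : supnorm Delta x0 = supnorm Delta (segment x 0).
  by apply: eq_supnorm => t tD; rewrite /segment add0r xx0.
apply: le_sqrt_sum.
- by rewrite mulr_ge0 ?expR_ge0// mulr_ge0// sqrtr_ge0.
- exact: mulr_ge0.
apply: (le_trans Hb); rewrite lerD2r !exprMn (sqr_sqrtr (ltW K0)).
have -> : expR (- (2 * eta) * b) = expR (- eta * b) ^+ 2.
  by rewrite expr2 -expRD; congr expR; ring.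
by [].
Qed.

End Estimate.
End Final.

Theorem theorem4 (R : realType) (Delta : R) (n m : nat)
    (alow aup a sigma : R) (P : 'M[R]_n) :
  0 <= Delta -> (0 < n)%N -> (0 < m)%N ->
  0 < alow -> 0 < aup -> 0 < a -> 0 < sigma -> symmetric_posdef P ->
  exists2 cbar : R, 0 < cbar &
    forall (f : (R -> 'cV[R]_n) -> 'cV[R]_m -> 'cV[R]_n)
           (V : (R -> 'cV[R]_n) -> R) (c : R) (gamma : R -> R),
      lipschitz_bounded_f Delta f ->
      f (fun _ => 0) 0 = 0 ->
      lipschitz_bounded_V Delta V ->
      (forall phi, cstate Delta n phi -> 0 <= V phi) ->
      0 <= c ->
      class_N gamma ->
      (forall phi, cstate Delta n phi ->
         alow * enorm (phi 0) ^+ 2 <= V phi <= aup * supnorm Delta phi ^+ 2) ->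
      (forall phi v, cstate Delta n phi ->
         (driver_derivative V phi (f phi v) <=
          (- a * enorm (phi 0) ^+ 2 + c * supnorm Delta phi ^+ 2
           + gamma (enorm v))%:E)%E) ->
      (forall phi v, cstate Delta n phi ->
         ((phi 0)^T *m P *m f phi v) 0 0 >=
         - sigma * (supnorm Delta phi ^+ 2 + gamma (enorm v))) ->
      c < cbar ->
      exp_ISS Delta f /\
      ((exists2 gamma0 : R, 0 <= gamma0 &
          forall s : R, 0 <= s -> gamma s = gamma0 * s ^+ 2) ->
       exp_ISS_linear_gain Delta f).
Proof.
move=> Delta0 n0 m0 alow0 aup0 a0 sigma0 P_posdef.
have [T [k [eta [C [T0 k0 eta0 C0 H]]]]] :=
  @trajectory_estimate R Delta n m P alow aup a sigma Delta0 alow0 a0 sigma0 P_posdef.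
(* The threshold for the absorption condition [2 * c * T <= alow]. *)
exists (alow / (2 * T)); first by rewrite divr_gt0// mulr_gt0.
move=> f V c gamma Lf _ LV _ c0 gN HV HVd HP; rewrite ltr_pdivlMr ?mulr_gt0// => cT.
have {cT} cT : 2 * c * T <= alow by rewrite (mulrC 2) -mulrA ltW.
have {}H := H f V c gamma Lf LV c0 gN HV HVd HP cT.
have est : exp_ISS_estimate Delta f k eta (fun s => Num.sqrt (C * gamma s)).
  move=> x0 u cx0 iu.
  have ubd := ess_norm_ae_bounded iu.
  have S0 := supnorm_ge0 Delta0 cx0.
  (* The bound must be uniform in [b']: the exponential is dropped and the input is measured on all
     of [[0, b]]. *)
  have apriori b b' x : 0 <= b' <= b -> trajectory f b' u x ->
      (forall t, - Delta <= t <= 0 -> x t = x0 t) ->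
      enorm (x b') <= k * supnorm Delta x0 + Num.sqrt (C * gamma (fine (ess_norm u b))).
    move=> /andP[b'0 b'b] tx xx0; have [U0 uU] := ubd b (le_trans b'0 b'b).
    apply: (le_trans (H u x x0 b' _ b'0 U0 (ae_boundedS b'b uU) tx xx0)).
    rewrite lerD2r ler_piMr ?mulr_ge0 ?(ltW k0)//.
    by rewrite -expR0 ler_expR mulNr oppr_le0 mulr_ge0// ltW.
  have [y soly] := global_solution Delta0 Lf cx0 iu apriori.
  have [ex maxT] := maximal_of_global Delta0 Lf iu soly.
  split => // T' x maxx; have T'oo := maxT T' x maxx; split => // t t0.
  have [solx _] := maxx; have [U0 uU] := ubd t t0.
  have tT : (t%:E < T')%E by rewrite T'oo ltry.
  have tx := solution_trajectory Delta0 Lf solx t0 tT.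
  have := H u _ x0 t _ t0 U0 uU tx; rewrite /= clampE ?lexx ?andbT; last first.
    by rewrite (le_trans _ t0)// oppr_le0.
  apply => s sD; rewrite clampE; last by case/andP: sD => -> s0; rewrite (le_trans s0).
  by apply: (solution_init solx); rewrite in_itv.
split.
  by exists k, eta, (fun s => Num.sqrt (C * gamma s)); split => //; exact: class_N_sqrt.
(* For quadratic [gamma] the gain found above, a square root of [C * gamma], is itself linear. *)
move=> [g0 g00 Hg]; exists k, eta, (Num.sqrt (C * g0)); split => //.
move=> x0 u cx0 iu; have [ex Hx] := est x0 u cx0 iu; split => // T' x maxx.
have [T'oo Ht] := Hx T' x maxx; split => // t t0.
have [U0 _] := ess_norm_ae_bounded iu t0.
have := Ht t t0; rewrite Hg// mulrA sqrtrM ?mulr_ge0// sqrtr_sqr ger0_norm//.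
Qed.
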